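(* Let $A,B$ be finite-dimensional quantum systems with fixed orthonormal (''classical'') bases, and let $\mathcal{E}_{B|A}$ be a classical channel operation: a CPTP map from $A$ to $B$ with $\mathcal{E}_{B|A}\mathcal{C}_{A|A}=\mathcal{E}_{B|A}$ and $\mathcal{C}_{B|B}\mathcal{E}_{B|A}=\mathcal{E}_{B|A}$, where $\mathcal{C}_{A|A},\mathcal{C}_{B|B}$ are the completely dephasing operations in the classical bases. Consider the entanglement-assisted converse bound $$\log M^{\mathrm{E}}_\epsilon(\mathcal{E}_{B|A})\le\max_{\rho_A}I^{\mathrm{ALL}}_\epsilon(\mathcal{E}_{B|A},\rho_A)$$ and, for any class of bipartite operations $\Omega$ containing $\mathrm{L}$, the unassisted converse bound $$\log M_\epsilon(\mathcal{E}_{B|A})\le\max_{\rho_A}I^{\Omega}_\epsilon(\mathcal{E}_{B|A},\rho_A).$$ In these bounds one can restrict the optimisation over average input states to states $\rho_A=\sum_xp(x)|x\rangle\langle x|_A$ diagonal in the classical basis; one can restrict the optimisation over $\sigma_B$ (in the definition of $I^\Omega_\epsilon$) to states diagonal in the classical basis of $B$; and one can restrict the test POVM element to be diagonal in the classical basis. Therefore both the entanglement-assisted and the unassisted converse bounds reduce to the Polyanskiy–Poor–Verdú (PPV) converse for finite alphabets when the channel is classical.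
   Context: PPV converse: for a classical channel with finite input and output alphabets and transition probabilities $W(y|x)$ (here $W(y|x)=\langle y|\mathcal{E}_{B|A}(|x\rangle\langle x|)|y\rangle$), it is the bound $\log M\le\max_p\min_q\big(-\log\beta_\epsilon(P_p\|p\times q)\big)$ on the size $M$ of codes with average error probability at most $\epsilon$, where $p,q$ range over probability distributions on the input and output alphabets, $P_p(x,y)=p(x)W(y|x)$, $(p\times q)(x,y)=p(x)q(y)$, and, for distributions on a finite set, $\beta_\epsilon(P^{(0)}\|P^{(1)}):=\min\{\sum_rP^{(1)}(r)T(r):0\le T(r)\le1,\ \sum_rP^{(0)}(r)T(r)\ge1-\epsilon\}$. Codes. An entanglement-assisted code of size $M$ consists of a state $\Psi_{A_EB_E}$ of finite-dimensional systems $A_E$ (sender), $B_E$ (receiver), encoding CPTP maps $\mathcal{C}(w)_{A|A_E}$ for $w\in\{1,\dots,M\}$, and a decoding POVM $\{D(\hat w)_{B_EB}\}_{\hat w=1}^M$; $\Pr(\hat W=\hat w|W=w)=\mathrm{Tr}\,D(\hat w)_{B_EB}\mathcal{E}_{B|A}\mathcal{C}(w)_{A|A_E}\Psi_{A_EB_E}$. It is unassisted if $A_E,B_E$ are trivial (one-dimensional). $M^{\mathrm{E}}_\epsilon(\mathcal{E}_{B|A})$ (resp. $M_\epsilon(\mathcal{E}_{B|A})$) is the largest size of an entanglement-assisted (resp. unassisted) code with average error probability at most $\epsilon$ for equiprobable messages. Classes and tests. A class $\Omega$ assigns to systems $\tilde A,B,A',B'$ a set of CPTP maps from $\tilde AB$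 to $A'B'$. $\mathrm{ALL}$ is the class of all CPTP maps; $\mathrm{L}$ (local operations and shared randomness) consists of the maps $\sum_rp_r\mathcal{F}^{(r)}_{A'|\tilde A}\otimes\mathcal{D}^{(r)}_{B'|B}$ with $\mathcal{F}^{(r)},\mathcal{D}^{(r)}$ CPTP and $p_r$ probabilities. $\mathrm{T}^\Omega(\tilde A{:}B)$ is the set of POVM elements $\mathcal{M}^\dagger\big(\sum_{a,b}T(a,b)|a\rangle\langle a|_{A'}\otimes|b\rangle\langle b|_{B'}\big)$ with $0\le T(a,b)\le1$ and $\mathcal{M}$ a map in $\Omega$ from $\tilde AB$ to $A'B'$ ($A',B'$ arbitrary) whose outputs are always diagonal in the classical (product) basis; $\mathcal{M}^\dagger$ is the adjoint map. For states of $\tilde AB$, $\beta^\Omega_\epsilon(\tau^{(0)}\|\tau^{(1)}):=\inf\{\mathrm{Tr}\,\tau^{(1)}T:T\in\mathrm{T}^\Omega(\tilde A{:}B),\ \mathrm{Tr}\,\tau^{(0)}T\ge1-\epsilon\}$. For a state $\rho_A$, $\tilde A$ is a copy of $A$, $\Phi_{\tilde A A}:=\sum_{i,j}|i\rangle_{\tilde A}|i\rangle_A\langle j|_{\tilde A}\langle j|_A$, $\rho_{\tilde A A}:=\rho_A^{1/2}\Phi_{\tilde AA}\rho_A^{1/2}$, $\rho_{\tilde A}:=\mathrm{Tr}_A\,\rho_{\tilde AA}$, and $$I^\Omega_\epsilon(\mathcal{E}_{B|A},\rho_A):=\min_{\sigma_B}\big(-\log\beta^\Omega_\epsilon(\mathcal{E}_{B|A}\rho_{\tilde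 AA}\|\rho_{\tilde A}\otimes\sigma_B)\big),$$ the minimum being over density operators $\sigma_B$ of $B$. *)

(* Defs.v *)
(* A finite-dimensional system with its classical basis is a dimension n : operators are 'M[R[i]]_n with R a
   realType, and |x> is the x-th standard basis vector.  The composite of
   systems of dimensions m, n has dimension m * n and product basis
   mxtens_index (i, j) = |i>|j>, matching the Kronecker product *t. *)
From mathcomp Require Import all_boot all_order all_algebra.
From mathcomp Require Import all_classical all_reals all_analysis.
From mathcomp.real_closed Require Export complex mxtens.

Set Implicit Arguments.
Unset Strict Implicit.
Unset Printing Implicit Defensive.

Import Order.TTheory GRing.Theory Num.Theory.
Local Open Scope ring_scope.
Local Open Scope classical_set_scope.
Local Open Scope complex_scope.
Local Open Scope sesquilinear_scope.

Notation "A *t B" := (tensmx A B)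
  (at level 40, left associativity, format "A  *t  B") : ring_scope.

(* Operators and states *)

(* On a complex space <v|X|v> >= 0 for all v forces X to be Hermitian; in the
   order of R[i], 0 <= z says that z is real and nonnegative. *)
Definition psd (R : realType) (n : nat) (X : 'M[R[i]]_n) : Prop :=
  forall v : 'cV[R[i]]_n, 0 <= (v ^t* *m X *m v) 0 0.

Definition density (R : realType) (n : nat) (rho : 'M[R[i]]_n) : Prop :=
  psd rho /\ \tr rho = 1.

(* [diag = true] keeps only the states diagonal in the classical basis. *)
Definition states (R : realType) (diag : bool) (n : nat) : set 'M[R[i]]_n :=
  [set rho | density rho /\ (diag -> is_diag_mx rho)].

(* The positive semidefinite square root (unique, for psd X). *)
Definition sqrt_mx (R : realType) (n : nat) (X : 'M[R[i]]_n) : 'M[R[i]]_n :=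
  xget 0 [set S | psd S /\ S *m S = X].

Definition ptrace2 (R : realType) (m n : nat) (X : 'M[R[i]]_(m * n)) :
    'M[R[i]]_m :=
  \matrix_(i, j) \sum_(k < n) X (mxtens_index (i, k)) (mxtens_index (j, k)).

Definition dephase (R : realType) (n : nat) (X : 'M[R[i]]_n) : 'M[R[i]]_n :=
  \sum_(x < n) delta_mx x x *m X *m delta_mx x x.

Definition is_dist (R : realType) (K : finType) (p : K -> R) : Prop :=
  (forall k, 0 <= p k) /\ \sum_k p k = 1.

(* sum_x p(x) |x><x| *)
Definition diag_state (R : realType) (n : nat) (p : 'I_n -> R) : 'M[R[i]]_n :=
  \sum_(x < n) (p x)%:C *: delta_mx x x.

(* Maps between systems *)

Definition opmap (R : realType) (m n : nat) : Type :=
  'M[R[i]]_m -> 'M[R[i]]_n.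

(* F (x) D for linear F and D, given by its values on |i><j| (x) |k><l|. *)
Definition tensmap (R : realType) (m n m' n' : nat)
    (F : opmap R m m') (D : opmap R n n') : opmap R (m * n) (m' * n') :=
  fun X => \sum_(i < m) \sum_(j < m) \sum_(k < n) \sum_(l < n)
    X (mxtens_index (i, k)) (mxtens_index (j, l))
      *: (F (delta_mx i j) *t D (delta_mx k l)).

Definition completely_positive (R : realType) (m n : nat) (f : opmap R m n) :
    Prop :=
  forall (k : nat) (X : 'M[R[i]]_(k * m)),
    psd X -> psd (tensmap (fun Y : 'M[R[i]]_k => Y) f X).

Definition cptp (R : realType) (m n : nat) (f : opmap R m n) : Prop :=
  [/\ linear f, completely_positive f & forall X, \tr (f X) = \tr X].

(* Adjoint for the Hilbert-Schmidt inner product <X, Y> = Tr (X^* Y). *)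
Definition adjoint_map (R : realType) (m n : nat) (f : opmap R m n) :
    opmap R n m :=
  fun Y => \matrix_(i, j) \tr ((f (delta_mx i j)) ^t* *m Y).

Definition classical_channel (R : realType) (dA dB : nat) (E : opmap R dA dB) :
    Prop :=
  [/\ cptp E, forall X, E (dephase X) = E X & forall X, dephase (E X) = E X].

(* W(y|x) = <y| E(|x><x|) |y> *)
Definition transition (R : realType) (dA dB : nat) (E : opmap R dA dB)
    (x : 'I_dA) (y : 'I_dB) : R :=
  complex.Re (E (delta_mx x x) y y).

(* Classes of bipartite operations *)

(* [Om m n m' n'] : maps from systems of dimensions m, n (sender, receiver)
   to systems of dimensions m', n'. *)
Definition opclass (R : realType) : Type :=
  forall m n m' n' : nat, set (opmap R (m * n) (m' * n')).

Definition is_opclass (R : realType) (Om : opclass R) : Prop :=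
  forall m n m' n' f, Om m n m' n' f -> cptp f.

Definition class_ALL (R : realType) : opclass R :=
  fun m n m' n' => [set f | cptp f].

Definition class_L (R : realType) : opclass R :=
  fun m n m' n' => [set f | exists (k : nat) (p : 'I_k -> R)
      (F : 'I_k -> opmap R m m') (D : 'I_k -> opmap R n n'),
    [/\ is_dist p, forall r, cptp (F r), forall r, cptp (D r) &
        forall X, f X = \sum_(r < k) (p r)%:C *: tensmap (F r) (D r) X]].

Definition subclass (R : realType) (Om Om' : opclass R) : Prop :=
  forall m n m' n', Om m n m' n' `<=` Om' m n m' n'.

(* T^Om; [diag = true] keeps only the tests diagonal in the product basis. *)
Definition tests (R : realType) (Om : opclass R) (diag : bool) (m n : nat) :
    set 'M[R[i]]_(m * n) :=
  [set T | (diag -> is_diag_mx T) /\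
    exists (m' n' : nat) (t : 'I_m' -> 'I_n' -> R)
           (f : opmap R (m * n) (m' * n')),
    [/\ forall a b, 0 <= t a b <= 1, Om m n m' n' f,
        forall X, is_diag_mx (f X) &
        T = adjoint_map f
              (\sum_(a < m') \sum_(b < n')
                 (t a b)%:C *: (delta_mx a a *t delta_mx b b))]].

(* Hypothesis testing and the converse bounds *)

Definition beta (R : realType) (Om : opclass R) (diag : bool) (eps : R)
    (m n : nat) (tau0 tau1 : 'M[R[i]]_(m * n)) : \bar R :=
  ereal_inf [set (complex.Re (\tr (tau1 *m T)))%:E | T in
    [set T | @tests R Om diag m n T /\
             1 - eps <= complex.Re (\tr (tau0 *m T))]].

(* Phi = sum_(i,j) |i>|i><j|<j| *)
Definition Phi (R : realType) (n : nat) : 'M[R[i]]_(n * n) :=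
  \sum_(i < n) \sum_(j < n) delta_mx i j *t delta_mx i j.

(* rho^(1/2) acts on the second factor A, the first factor being its copy. *)
Definition purif (R : realType) (n : nat) (rho : 'M[R[i]]_n) :
    'M[R[i]]_(n * n) :=
  (1%:M *t sqrt_mx rho) *m Phi R n *m (1%:M *t sqrt_mx rho).

Definition joint_state (R : realType) (dA dB : nat) (E : opmap R dA dB)
    (rho : 'M[R[i]]_dA) : 'M[R[i]]_(dA * dB) :=
  tensmap (fun Y : 'M[R[i]]_dA => Y) E (purif rho).

Definition product_state (R : realType) (dA dB : nat)
    (rho : 'M[R[i]]_dA) (sigma : 'M[R[i]]_dB) : 'M[R[i]]_(dA * dB) :=
  ptrace2 (purif rho) *t sigma.

(* I^Om_eps(E, rho), with the restrictions to diagonal sigma ([sdiag]) and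
   diagonal tests ([tdiag]) as options.  lne is the natural logarithm on
   \bar R, with - lne 0 = +oo. *)
Definition info (R : realType) (Om : opclass R) (sdiag tdiag : bool)
    (eps : R) (dA dB : nat) (E : opmap R dA dB) (rho : 'M[R[i]]_dA) : \bar R :=
  ereal_inf [set (- lne (beta Om tdiag eps (joint_state E rho)
                              (product_state rho sigma)))%E
    | sigma in @states R sdiag dB].

(* max over rho of I^Om_eps(E, rho), with the three restrictions as options. *)
Definition max_info (R : realType) (Om : opclass R) (rdiag sdiag tdiag : bool)
    (eps : R) (dA dB : nat) (E : opmap R dA dB) : \bar R :=
  ereal_sup [set info Om sdiag tdiag eps E rho | rho in @states R rdiag dA].

(* The Polyanskiy-Poor-Verdu converse *)

Definition is_test (R : realType) (K : finType) (eps : R) (P0 : K -> R)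
    (T : K -> R) : Prop :=
  (forall k, 0 <= T k <= 1) /\ 1 - eps <= \sum_k P0 k * T k.

Definition beta_cl (R : realType) (K : finType) (eps : R) (P0 P1 : K -> R) :
    \bar R :=
  ereal_inf [set (\sum_k P1 k * T k)%:E | T in is_test eps P0].

Definition joint_dist (R : realType) (dA dB : nat) (W : 'I_dA -> 'I_dB -> R)
    (p : 'I_dA -> R) : 'I_dA * 'I_dB -> R :=
  fun k => p k.1 * W k.1 k.2.

Definition product_dist (R : realType) (dA dB : nat)
    (p : 'I_dA -> R) (q : 'I_dB -> R) : 'I_dA * 'I_dB -> R :=
  fun k => p k.1 * q k.2.

Definition ppv_beta (R : realType) (eps : R) (dA dB : nat)
    (W : 'I_dA -> 'I_dB -> R) (p : 'I_dA -> R) (q : 'I_dB -> R) : \bar R :=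
  beta_cl eps (joint_dist W p) (product_dist p q).

Definition ppv_info (R : realType) (eps : R) (dA dB : nat)
    (W : 'I_dA -> 'I_dB -> R) (p : 'I_dA -> R) : \bar R :=
  ereal_inf [set (- lne (ppv_beta eps W p q))%E
    | q in @is_dist R 'I_dB].

Definition ppv (R : realType) (eps : R) (dA dB : nat)
    (W : 'I_dA -> 'I_dB -> R) : \bar R :=
  ereal_sup [set ppv_info eps W p | p in @is_dist R 'I_dA].

(* Codes *)

(* The shared state is ordered receiver-first (B_E, A_E), so that encoder and
   channel act on the second factor and give a state of (B_E, B). *)
Record ea_code (R : realType) (M dA dB dAE dBE : nat) : Type := EACode {
  code_state : 'M[R[i]]_(dBE * dAE);
  code_enc : 'I_M -> opmap R dAE dA;
  code_dec : 'I_M -> 'M[R[i]]_(dBE * dB) }.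

Definition is_ea_code (R : realType) (M dA dB dAE dBE : nat)
    (c : ea_code R M dA dB dAE dBE) : Prop :=
  [/\ density (code_state c), forall w, cptp (code_enc c w),
      forall w, psd (code_dec c w) & \sum_w code_dec c w = 1%:M].

(* Pr(w' | w) *)
Definition code_prob (R : realType) (M dA dB dAE dBE : nat)
    (E : opmap R dA dB) (c : ea_code R M dA dB dAE dBE) (w w' : 'I_M) : R :=
  complex.Re (\tr (code_dec c w' *m
    tensmap (fun Y : 'M[R[i]]_dBE => Y) (fun X => E (code_enc c w X))
            (code_state c))).

Definition code_error (R : realType) (M dA dB dAE dBE : nat)
    (E : opmap R dA dB) (c : ea_code R M dA dB dAE dBE) : R :=
  M%:R^-1 * \sum_w \sum_(w' | w' != w) code_prob E c w w'.

(* The sizes M > 0 of the codes with average error at most eps whose assistance systems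
   have dimensions dAE, dBE. *)
Definition achievable (R : realType) (eps : R) (dA dB : nat)
    (E : opmap R dA dB) (dAE dBE : nat) : set nat :=
  [set M | (0 < M)%N /\ exists c : ea_code R M dA dB dAE dBE,
     is_ea_code c /\ code_error E c <= eps].

Definition max_size_EA (R : realType) (eps : R) (dA dB : nat)
    (E : opmap R dA dB) : \bar R :=
  ereal_sup [set (M%:R : R)%:E | M in
    [set M | exists dAE dBE : nat, achievable eps E dAE dBE M]].

Definition max_size (R : realType) (eps : R) (dA dB : nat)
    (E : opmap R dA dB) : \bar R :=
  ereal_sup [set (M%:R : R)%:E | M in achievable eps E 1 1].

(* Main.v *)
Require Import Defs.
From mathcomp Require Import all_boot all_order all_algebra.
From mathcomp Require Import all_classical all_reals all_analysis.
From mathcomp Require Import ring lra.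

(* A classical channel sees only the diagonal of its input, so with S = rho^(1/2) both
   hypotheses are mixtures of the same operators u u^*, u_xy = (row x of S)^T (x) |y>,
   with weights W(y|x) and q(y).  For a quantum test T the numbers N(x, y) = u^* T u
   satisfy 0 <= N(x, y) <= p(x) = rho_xx, so N / p is a classical test with the same two
   error probabilities; conversely, dephasing is local, so every classical test is
   available in any class containing L.  Hence I(E, rho) is at most the PPV quantity at
   p, with equality for diagonal rho.  A code likewise yields a classical test
   T(x, y), the probability of decoding the message sent given channel input x and
   output y; it accepts p x q with probability exactly 1 / M, since the receiver's
   share of the entanglement carries no information on the message.  The optima are
   attained by compactness; for the maximum over p one uses that
   {p | beta(p, q) <= c} is the projection of a compact set of pairs (p, N). *)

Set Implicit Arguments.
Unset Strict Implicit.
Unset Printing Implicit Defensive.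

(** * Positive matrices *)

Section PositiveMatrices.
Import Order.TTheory GRing.Theory Num.Theory.
Local Open Scope ring_scope.
Local Open Scope sesquilinear_scope.
Variable C : numClosedFieldType.

(* [psd] over an abstract field; [psd] on R[i] is convertible to it. *)
Definition posmx n (X : 'M[C]_n) : Prop :=
  forall v : 'cV[C]_n, 0 <= (v ^t* *m X *m v) 0 0.

Lemma quad_formE n (X : 'M[C]_n) (v : 'cV[C]_n) :
  (v ^t* *m X *m v) 0 0 = \sum_i \sum_j (v i 0)^* * X i j * v j 0.
Proof.
rewrite mxE exchange_big; apply: eq_bigr => j _; rewrite mxE mulr_suml.
by apply: eq_bigr => i _; rewrite !mxE.
Qed.

Lemma posmxP n (X : 'M[C]_n) :
  posmx X <-> forall w : 'I_n -> C, 0 <= \sum_i \sum_j (w i)^* * X i j * w j.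
Proof.
split=> [psdX w|H v]; last by rewrite quad_formE; exact: H.
have := psdX (\col_i w i); rewrite quad_formE.
by under eq_bigr do under eq_bigr do rewrite !mxE.
Qed.

Lemma posmx_congr m n (V : 'M[C]_(n, m)) (X : 'M[C]_n) :
  posmx X -> posmx (V ^t* *m X *m V).
Proof.
move=> psdX v; have := psdX (V *m v).
by rewrite trmx_mul map_mxM !mulmxA.
Qed.

(** This is congruence by the matrix whose column [a] carries [g a] in row [f a] and zeros
    elsewhere. It covers compressions, embeddings and rank-one operators. *)
Lemma posmx_reindex m n (X : 'M[C]_n) (f : 'I_m -> 'I_n) (g : 'I_m -> C) :
  posmx X -> posmx (\matrix_(a, b) ((g a)^* * X (f a) (f b) * g b)).
Proof.
move=> /(posmx_congr (\matrix_(k, a) (g a *+ (k == f a)))).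
congr (posmx _); apply/matrixP => a b; rewrite !mxE (bigD1 (f b)) //=.
rewrite big1 ?addr0 => [|k /negPf nk]; last by rewrite !mxE nk mulr0.
rewrite !mxE eqxx (bigD1 (f a)) //= big1 ?addr0 => [|k /negPf nk].
  by rewrite !mxE eqxx.
by rewrite !mxE nk rmorph0 mul0r.
Qed.

Lemma posmx_diag_ge0 n (X : 'M[C]_n) i : posmx X -> 0 <= X i i.
Proof.
move=> /(_ (delta_mx i 0)); rewrite -colE.
by rewrite trmx_delta map_delta_mx -rowE !mxE.
Qed.

Lemma posmx_tr_ge0 n (X : 'M[C]_n) : posmx X -> 0 <= \tr X.
Proof. by move=> psdX; apply: sumr_ge0 => i _; apply: posmx_diag_ge0. Qed.

Lemma posmx_sum (I : Type) (r : seq I) (P : pred I) n (F : I -> 'M[C]_n) :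
  (forall i, P i -> posmx (F i)) -> posmx (\sum_(i <- r | P i) F i).
Proof.
move=> psdF v; rewrite mulmx_sumr mulmx_suml summxE.
by apply: sumr_ge0 => i Pi; apply: psdF.
Qed.

Lemma posmx_diag_mx n (d : 'rV[C]_n) :
  (forall i, 0 <= d 0 i) -> posmx (diag_mx d).
Proof.
move=> d0; apply/posmxP => w; apply: sumr_ge0 => i _.
rewrite (bigD1 i) //= big1 ?addr0 => [|j ji]; last first.
  by rewrite !mxE eq_sym (negPf ji) mulr0 mul0r.
by rewrite mxE eqxx mulr1n mulrAC mulr_ge0 // mulrC mul_conjC_ge0.
Qed.

(* Polarization: the quadratic form is real at e_i, e_j and e_i + c e_j for c = 1, 'i. *)
Lemma posmx_herm n (X : 'M[C]_n) : posmx X -> X ^t* = X.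
Proof.
move=> psdX; apply/matrixP => i j; rewrite !mxE.
have [->|nij] := eqVneq i j.
  by apply/eqP; rewrite -CrealE ger0_real // posmx_diag_ge0.
have pol c : X i j * c + c^* * X j i \is Num.real.
  pose v : 'cV[C]_n := delta_mx i 0 + c *: delta_mx j 0.
  have -> : X i j * c + c^* * X j i =
      (v ^t* *m X *m v) 0 0 - X i i - c^* * c * X j j.
    have del k l : ((delta_mx 0 k : 'rV[C]_n) *m X *m (delta_mx l 0 : 'cV[C]_n)) 0 0
        = X k l.
      by rewrite -rowE -colE !mxE.
    have -> : v ^t* = delta_mx 0 i + c^* *: delta_mx 0 j.
      by apply/rowP => k; rewrite !mxE rmorphD rmorphM /= !rmorph_nat !andbT.
    rewrite /v !mulmxDl !mulmxDr -!scalemxAr -!scalemxAl.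
    have addE (A B : 'M[C]_1) : (A + B) 0 0 = A 0 0 + B 0 0 by rewrite mxE.
    have scaleE a (A : 'M[C]_1) : (a *: A) 0 0 = a * A 0 0 by rewrite mxE.
    by rewrite !(addE, scaleE, del); ring.
  apply: rpredB; first apply: rpredB; apply: ger0_real.
  - exact: psdX.
  - exact: posmx_diag_ge0.
  - by apply: mulr_ge0; rewrite ?posmx_diag_ge0 // mulrC mul_conjC_ge0.
have := pol 1; rewrite rmorph1 mulr1 mul1r => /CrealP; rewrite rmorphD /= => H1.
have := pol 'i; rewrite conjCi => /CrealP.
rewrite rmorphD !rmorphM /= rmorphN /= conjCi => H2.
have i0 : ('i : C) != 0 by rewrite neq0Ci.
have {}H2 : (X j i)^* - (X i j)^* = X i j - X j i.
  apply: (mulfI i0).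
  have -> : 'i * ((X j i)^* - (X i j)^*) = (X i j)^* * - 'i + - - 'i * (X j i)^*.
    by ring.
  by rewrite H2; ring.
apply: (@mulfI _ (2 : C)); first by rewrite pnatr_eq0.
have -> : 2 * (X j i)^* = ((X i j)^* + (X j i)^*) + ((X j i)^* - (X i j)^*) by ring.
by rewrite H1 H2; ring.
Qed.

Lemma posmx_hermE n (X : 'M[C]_n) i j : posmx X -> X i j = (X j i)^*.
Proof. by move=> /posmx_herm {1}<-; rewrite !mxE. Qed.

Lemma posmx_sqrt_ex n (X : 'M[C]_n) : posmx X ->
  exists2 S : 'M[C]_n, posmx S & S *m S = X.
Proof.
move=> pX; have hX : X \is hermsymmx.
  by apply/is_hermitianmxP; rewrite expr0 scale1r posmx_herm.
have /hermitian_normalmx /orthomx_spectralP XE := hX.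
set P := spectralmx X in XE; set d := spectral_diag X in XE.
have Pu : P \is unitarymx by apply: spectral_unitarymx.
have PP : P *m P ^t* = 1%:M by apply/unitarymxP.
rewrite invmx_unitary // in XE.
(* [d 0 i] is a diagonal entry of the congruence [P X P^*]. *)
have d0 i : 0 <= d 0 i.
  have := posmx_diag_ge0 i (posmx_congr (P ^t* ) pX).
  rewrite XE trmxCK !mulmxA PP mul1mx -mulmxA PP mulmx1.
  by rewrite mxE eqxx.
pose s := \row_i sqrtC (d 0 i).
exists (P ^t* *m diag_mx s *m P).
  by apply: posmx_congr; apply: posmx_diag_mx => i; rewrite mxE sqrtC_ge0.
rewrite [RHS]XE !mulmxA -[_ *m P *m P ^t*]mulmxA PP mulmx1.
rewrite -[_ *m diag_mx s *m diag_mx s]mulmxA mulmx_diag.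
congr (_ *m diag_mx _ *m _); apply/rowP => i; rewrite !mxE.
by rewrite -expr2 sqrtCK.
Qed.

(** With [X = S S], cyclicity turns the trace into that of the congruence [S D S]. *)
Lemma posmx_tr_mul_ge0 n (D X : 'M[C]_n) :
  posmx D -> posmx X -> 0 <= \tr (D *m X).
Proof.
move=> pD /posmx_sqrt_ex[S pS <-]; rewrite mulmxA mxtrace_mulC mulmxA.
by rewrite -{1}(posmx_herm pS) posmx_tr_ge0 //; apply: posmx_congr.
Qed.

(** For Hermitian [X], each diagonal entry of [X X] is the sum of the squared moduli along a row of
    [X]. *)
Lemma herm_sqr_eq0 n (X : 'M[C]_n) : X ^t* = X -> X *m X = 0 -> X = 0.
Proof.
move=> hX XX; apply/matrixP => i j; rewrite mxE.
have := congr1 (fun Y : 'M[C]_n => Y i i) XX; rewrite !mxE => /eqP.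
rewrite psumr_eq0 => [/allP/(_ j)|k _].
  rewrite mem_index_enum => /(_ isT) /=.
  by rewrite -{2}hX !mxE mul_conjC_eq0 => /eqP.
by rewrite -{2}hX !mxE mul_conjC_ge0.
Qed.

Lemma posmx_tr_eq0 n (X : 'M[C]_n) : posmx X -> \tr X = 0 -> X = 0.
Proof.
move=> pX tX; have [S pS SX] := posmx_sqrt_ex pX.
rewrite -SX; suff -> : S = 0 by rewrite mul0mx.
apply/matrixP => i j; rewrite mxE.
have /eqP := tX; rewrite psumr_eq0 => [/allP/(_ i)|k _]; last exact: posmx_diag_ge0.
rewrite mem_index_enum => /(_ isT) /=.
rewrite -SX mxE psumr_eq0 => [/allP/(_ j)|k _].
  rewrite mem_index_enum => /(_ isT) /=.
  by rewrite (posmx_hermE j i pS) mul_conjC_eq0 => /eqP.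
by rewrite (posmx_hermE k i pS) mul_conjC_ge0.
Qed.

(* A positive root S of a diagonal matrix commutes with it, hence with its root Q;
   then (S - Q) (S + Q) (S - Q) = 0 is a sum of two positive matrices. *)
Lemma posmx_sqrt_diag n (d : 'rV[C]_n) (S : 'M[C]_n) :
  (forall i, 0 <= d 0 i) -> posmx S -> S *m S = diag_mx d ->
  S = diag_mx (\row_i sqrtC (d 0 i)).
Proof.
move=> d0 pS SS; set s := \row_i _; set Q := diag_mx s.
have pQ : posmx Q by apply: posmx_diag_mx => i; rewrite mxE sqrtC_ge0.
have QQ : Q *m Q = diag_mx d.
  rewrite mulmx_diag; congr diag_mx; apply/rowP => i.
  by rewrite !mxE -expr2 sqrtCK.
have SD : S *m diag_mx d = diag_mx d *m S by rewrite -SS mulmxA.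
have SQ : S *m Q = Q *m S.
  (* Entrywise, [S i j * d j = d i * S i j]: where [S i j] is nonzero the two entries of [d] agree,
     and so do their roots. *)
  apply/matrixP => i j; rewrite mul_mx_diag mul_diag_mx !mxE.
  have := congr1 (fun Y : 'M[C]_n => Y i j) SD.
  rewrite mul_mx_diag mul_diag_mx !mxE => /eqP.
  rewrite mulrC -subr_eq0 -mulrBl mulf_eq0 subr_eq0 => /orP[/eqP->|/eqP->].
    by rewrite mulrC.
  by rewrite mulr0 mul0r.
have hB : (S - Q) ^t* = S - Q.
  by rewrite linearB map_mxB /= !posmx_herm.
have B0 : (S - Q) *m (S + Q) = 0.
  by rewrite mulmxBl !mulmxDr SS QQ SQ [X in X - _]addrC subrr.
have pBS : posmx ((S - Q) *m S *m (S - Q)) by rewrite -{1}hB; apply: posmx_congr.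
have pBQ : posmx ((S - Q) *m Q *m (S - Q)) by rewrite -{1}hB; apply: posmx_congr.
have BB : (S - Q) *m S *m (S - Q) + (S - Q) *m Q *m (S - Q) = 0.
  by rewrite -mulmxDl -mulmxDr B0 mul0mx.
have /eqP := congr1 mxtrace BB; rewrite linearD linear0 /=.
rewrite paddr_eq0 ?posmx_tr_ge0 // => /andP[/eqP tS /eqP tQ].
have BSB := posmx_tr_eq0 pBS tS; have BQB := posmx_tr_eq0 pBQ tQ.
(* [(S - Q)^3] is the difference of two vanishing terms. Hence the Hermitian [(S - Q)^2] squares to
   zero, so it vanishes, and then so does [S - Q]. *)
have B3 : (S - Q) *m (S - Q) *m (S - Q) = 0.
  by rewrite [X in X *m _]mulmxBr mulmxBl BSB BQB subrr.
apply/eqP; rewrite -subr_eq0; apply/eqP; apply: (herm_sqr_eq0 hB).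
apply: herm_sqr_eq0; first by rewrite trmx_mul map_mxM hB.
by rewrite mulmxA B3 mul0mx.
Qed.

End PositiveMatrices.

(** * Compactness and the PPV converse *)

Section Compactness.
Import Order.TTheory GRing.Theory Num.Theory.
Import numFieldNormedType.Exports.
Local Open Scope ring_scope.
Local Open Scope classical_set_scope.

(** Sublevel sets of a map into a total order are nested and generate a proper filter; being closed,
    they all contain its cluster point. Closed sublevel sets express lower semicontinuity, which
    suits the [\bar R]-valued objectives below. *)
Lemma compact_attains_min d (O : orderType d) (T : topologicalType)
    (A : set T) (f : T -> O) :
  compact A -> A !=set0 ->
  (forall y, A y -> closed (A `&` [set x | (f x <= f y)%O])) ->
  exists2 x, A x & forall y, A y -> (f x <= f y)%O.
Proof.
move=> cA [a Aa] fA; pose B y := A `&` [set x | (f x <= f y)%O].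
have BF : Filter (filter_from A B).
  apply: filter_from_filter; first by exists a.
  move=> y z Ay Az; case: (leP (f y) (f z)) => yz.
    by exists y => // x [Ax /= xy]; split; split => //=; exact: le_trans yz.
  exists z => // x [Ax /= xz]; split; split => //=.
  exact: le_trans (ltW yz).
have BP : ProperFilter (filter_from A B).
  by apply: filter_from_proper => y Ay; exists y; split => /=.
have [|x [Ax clx]] := cA _ BP; first by exists a => // x [].
exists x => // y Ay.
suff [] : B y x by [].
rewrite (closure_id (B y)).1; last exact: fA.
by move=> U /clx; apply; exists y.
Qed.

Variable R : realType.

Lemma continuous_lin (K : finType) (c : K -> R) :
  continuous (fun f : {ptws K -> R} => \sum_k c k * f k).
Proof.
apply: (@continuous_big _ _ +%R 0 xpredT add_continuous) => k _ f.
apply: (@continuous_comp _ _ _ (fun f : {ptws K -> R} => f k)).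
  exact: (@proj_continuous K (fun=> R) k).
exact: mulrl_continuous.
Qed.

Lemma closed_fun_ge (T : topologicalType) (g : T -> R) (c : R) :
  continuous g -> closed [set x | c <= g x].
Proof.
by move=> cg; apply: (preimage_closed (D := [set y | c <= y])) (@closed_ge _ c) => x _; exact: cg.
Qed.

Lemma closed_fun_le (T : topologicalType) (g : T -> R) (c : R) :
  continuous g -> closed [set x | g x <= c].
Proof.
by move=> cg; apply: (preimage_closed (D := [set y | y <= c])) (@closed_le _ c) => x _; exact: cg.
Qed.

Lemma compact_cube (K : finType) :
  compact [set f : {ptws K -> R} | forall k, 0 <= f k <= 1].
Proof.
have := @tychonoff K (fun=> R) (fun=> `[0, 1]%classic) (fun=> @segment_compact R 0 1).
by congr compact; apply/seteqP; split => f /= H k; have := H k; rewrite in_itv.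
Qed.

Lemma is_dist_le1 (K : finType) (p : K -> R) k : is_dist p -> p k <= 1.
Proof.
by move=> [p0 <-]; rewrite (bigD1 k) //= lerDl sumr_ge0.
Qed.

Lemma is_dist_point (K : finType) (k0 : K) :
  is_dist (fun k => (k == k0)%:R : R).
Proof.
split=> [k|]; first exact: ler0n.
by rewrite (bigD1 k0) //= eqxx big1 ?addr0 // => k /negPf ->.
Qed.

Lemma compact_is_dist (K : finType) : compact (@is_dist R K : set {ptws K -> R}).
Proof.
have lc : continuous (fun f : {ptws K -> R} => \sum_k f k).
  rewrite (_ : (fun f => _) = (fun f : {ptws K -> R} => \sum_k 1 * f k)).
    exact: continuous_lin.
  by apply/funext => f; apply: eq_bigr => k _; rewrite mul1r.
apply: (subclosed_compact _ (@compact_cube K)); last first.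
  by move=> p dp k; rewrite dp.1 is_dist_le1.
have -> : (@is_dist R K : set {ptws K -> R}) =
    (\bigcap_(k in setT) [set f : {ptws K -> R} | 0 <= f k]) `&`
    ([set f : {ptws K -> R} | 1 <= \sum_k f k] `&`
     [set f : {ptws K -> R} | \sum_k f k <= 1]).
  apply/seteqP; split => f /=.
    by move=> [f0 ->]; split; [move=> k _; exact: f0|split].
  move=> [f0 [f1 f1']]; split; first by move=> k; exact: f0.
  by apply/eqP; rewrite eq_le f1 f1'.
apply: closedI; last by apply: closedI; [apply: closed_fun_ge|apply: closed_fun_le].
apply: closed_bigI => k _; apply: closed_fun_ge.
exact: (@proj_continuous K (fun=> R) k).
Qed.

Lemma ptws_hausdorff (K : finType) : hausdorff_space {ptws K -> R}.
Proof. by apply: (@hausdorff_product K (fun=> R)) => k; exact: Rhausdorff. Qed.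

End Compactness.

(** * The PPV converse: attainment of its optima *)

Section PPV.
Import Order.TTheory GRing.Theory Num.Theory.
Import numFieldNormedType.Exports.
Local Open Scope ring_scope.
Local Open Scope classical_set_scope.
Variable R : realType.

Lemma ge0_lee_lne (x y : \bar R) :
  (0 <= x -> 0 <= y -> (lne x <= lne y) = (x <= y))%E.
Proof. by move=> x0 y0; rewrite lee_lne // in_itv /= leey ?x0 ?y0. Qed.

(** [lne] is [-oo] at every nonpositive argument, hence below all other values. *)
Lemma le_lne (x y : \bar R) : (x <= y)%E -> (lne x <= lne y)%E.
Proof.
move=> xy; have [x0|x0] := leP x 0%E; first by rewrite le0_lneNy // leNye.
by rewrite ge0_lee_lne // ltW // (lt_le_trans x0).
Qed.

Lemma beta_cl_le (K : finType) (eps : R) (P0 P1 T : K -> R) :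
  is_test eps P0 T -> (beta_cl eps P0 P1 <= (\sum_k P1 k * T k)%:E)%E.
Proof. by move=> HT; apply: ereal_inf_lbound; exists T. Qed.

Lemma beta_cl_attained (K : finType) (eps : R) (P0 P1 : K -> R) :
  is_dist P0 -> 0 <= eps ->
  exists2 T, is_test eps P0 T & beta_cl eps P0 P1 = (\sum_k P1 k * T k)%:E.
Proof.
move=> dP0 eps0.
have cT : compact (is_test eps P0 : set {ptws K -> R}).
  apply: (@compact_closedI _ [set f : {ptws K -> R} | forall k, 0 <= f k <= 1]
    [set f : {ptws K -> R} | 1 - eps <= \sum_k P0 k * f k]); first exact: compact_cube.
  exact/closed_fun_ge/continuous_lin.
have [||T HT minT] := @compact_attains_min _ _ _ _
    (fun f : {ptws K -> R} => \sum_k P1 k * f k) cT.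
(* The constant test 1 is accepted with probability 1, which is at least [1 - eps] since
   [eps >= 0]. *)
- exists (fun=> 1); split; first by move=> k; rewrite lexx ler01.
  by under eq_bigr do rewrite mulr1; rewrite dP0.2 lerBlDr lerDl.
- move=> T HT; apply: closedI; first exact: compact_closed (@ptws_hausdorff _ _) cT.
  exact/closed_fun_le/continuous_lin.
exists T => //; apply/eqP; rewrite eq_le beta_cl_le //=.
by apply: le_ereal_inf_tmp => _ [S HS <-]; rewrite lee_fin minT.
Qed.

Lemma sum_pairE (V : nmodType) (I J : finType) (F : I * J -> V) :
  \sum_k F k = \sum_i \sum_j F (i, j).
Proof. by rewrite pair_bigA; apply: eq_bigr => -[]. Qed.

Variables (dA dB : nat) (W : 'I_dA -> 'I_dB -> R) (eps : R).
Hypothesis W_dist : forall x, is_dist (W x).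
Hypothesis eps_ge0 : 0 <= eps.

Lemma joint_dist_is_dist p : is_dist p -> is_dist (joint_dist W p).
Proof.
move=> [p0 p1]; split=> [[x y]|]; first by rewrite mulr_ge0 // (W_dist x).1.
rewrite sum_pairE -p1; apply: eq_bigr => x _.
by rewrite /joint_dist /= -mulr_sumr (W_dist x).2 mulr1.
Qed.

Lemma ppv_beta_attained p q : is_dist p ->
  exists2 T, is_test eps (joint_dist W p) T &
    ppv_beta eps W p q = (\sum_k product_dist p q k * T k)%:E.
Proof. by move=> dp; apply: beta_cl_attained => //; exact: joint_dist_is_dist. Qed.

Lemma ppv_beta_ge0 p q : is_dist p -> is_dist q -> (0 <= ppv_beta eps W p q)%E.
Proof.
move=> dp dq; apply: le_ereal_inf_tmp => _ [T [T01 _] <-].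
rewrite lee_fin; apply: sumr_ge0 => -[x y] _.
by rewrite !mulr_ge0 ?dp.1 ?dq.1 //; case/andP: (T01 (x, y)).
Qed.

(* N (x, y) = p x * T (x, y) reparametrizes a test T; where p x = 0, division
   gives T = 0, consistently with N = 0. *)
Lemma ppv_beta_le p q (N : 'I_dA * 'I_dB -> R) :
  (forall k, 0 <= N k <= p k.1) -> 1 - eps <= \sum_k W k.1 k.2 * N k ->
  (ppv_beta eps W p q <= (\sum_k q k.2 * N k)%:E)%E.
Proof.
move=> N0p HN; pose T k := N k / p k.1.
have pT k : p k.1 * T k = N k.
  have [p0|p0] := eqVneq (p k.1) 0; last by rewrite mulrC divfK.
  by have := N0p k; rewrite /T p0 mul0r => /le_anti.
have -> : \sum_k q k.2 * N k = \sum_k product_dist p q k * T k.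
  by apply: eq_bigr => k _; rewrite /product_dist mulrAC pT mulrC.
apply: beta_cl_le; split=> [k|].
  have /andP[Nk Np] := N0p k; have pk : 0 <= p k.1 by apply: le_trans Np.
  rewrite divr_ge0 //=; have [p0|p0] := eqVneq (p k.1) 0.
    by rewrite /T p0 invr0 mulr0 ler01.
  by rewrite ler_pdivrMr ?mul1r // lt_def p0.
apply: le_trans HN _; rewrite le_eqVlt; apply/orP; left; apply/eqP.
by apply: eq_bigr => k _; rewrite /joint_dist mulrAC pT mulrC.
Qed.

(** In the variable [N = p T] the conditions become linear inequalities in the pair [(p, N)].
    Attainment of the minimum is what yields an exact [<= c]. *)
Lemma ppv_beta_leP p q (c : R) : is_dist p ->
  (ppv_beta eps W p q <= c%:E)%E <->
  exists N : 'I_dA * 'I_dB -> R,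
    [/\ forall k, 0 <= N k <= p k.1, 1 - eps <= \sum_k W k.1 k.2 * N k
      & \sum_k q k.2 * N k <= c].
Proof.
move=> dp; split=> [|[N [N0p HN Nc]]]; last first.
  by apply: le_trans (ppv_beta_le q N0p HN) _; rewrite lee_fin.
have [T [T01 HT] ->] := ppv_beta_attained q dp; rewrite lee_fin => Tc.
exists (fun k => p k.1 * T k); split.
- move=> k; have /andP[T0 T1] := T01 k.
  by rewrite mulr_ge0 ?dp.1 //= -[leRHS]mulr1 ler_wpM2l ?dp.1.
- apply: le_trans HT _; rewrite le_eqVlt; apply/orP; left; apply/eqP.
  by apply: eq_bigr => k _; rewrite /joint_dist mulrA [W _ _ * _]mulrC.
apply: le_trans Tc; rewrite le_eqVlt; apply/orP; left; apply/eqP.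
by apply: eq_bigr => k _; rewrite /product_dist mulrA [q _ * _]mulrC.
Qed.

Lemma ppv_info_attained p : (0 < dB)%N -> is_dist p ->
  exists2 q, is_dist q & ppv_info eps W p = (- lne (ppv_beta eps W p q))%E.
Proof.
move=> dB0 dp.
have [||q dq maxq] := @compact_attains_min _ _ _ _
    (fun q : {ptws 'I_dB -> R} => - ppv_beta eps W p q)%E (@compact_is_dist R 'I_dB).
- by exists (fun y => (y == Ordinal dB0)%:R); exact: is_dist_point.
- move=> q dq; have [T0 _ b0] := ppv_beta_attained q dp.
  (* For fixed [p], beta is an infimum of linear functions of [q], so doing at least as well as [q]
     is one closed half-space condition on [q'] per test. [T0] supplies the value at [q]. *)
  rewrite (_ : _ `&` _ = (@is_dist R 'I_dB : set {ptws 'I_dB -> R}) `&`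
    \bigcap_(T in is_test eps (joint_dist W p))
      [set q' : {ptws 'I_dB -> R} | \sum_k product_dist p q k * T0 k <=
         \sum_y (\sum_x p x * T (x, y)) * q' y]).
    apply: closedI; first exact: compact_closed (@ptws_hausdorff _ _) (@compact_is_dist _ _).
    apply: closed_bigI => T HT; exact/closed_fun_ge/continuous_lin.
  have sumE q' (T : 'I_dA * 'I_dB -> R) :
      \sum_y (\sum_x p x * T (x, y)) * q' y = \sum_k product_dist p q' k * T k.
    rewrite sum_pairE.
    rewrite exchange_big; apply: eq_bigr => y _; rewrite mulr_suml.
    by apply: eq_bigr => x _; rewrite /product_dist /= mulrAC.
  apply/seteqP; split => q' [dq' /= H]; split => //.
    move=> T HT /=; rewrite sumE -lee_fin -b0.
    by apply: le_trans (beta_cl_le _ HT); rewrite -leeN2.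
  rewrite /= leeN2 b0; apply: le_ereal_inf_tmp => _ [T HT <-].
  by have := H T HT; rewrite /= sumE lee_fin.
exists q => //; apply/eqP; rewrite eq_le; apply/andP; split.
  by apply: ereal_inf_lbound; exists q.
apply: le_ereal_inf_tmp => _ [q' dq' <-]; rewrite leeN2 le_lne //.
by rewrite -leeN2; exact: maxq.
Qed.

(** By [ppv_beta_leP] this is the projection of the set [F] of pairs [(p, N)]. The bounds
    [N <= p <= 1] keep [F] in a compact product, and a compact image in a Hausdorff space is
    closed. *)
Lemma closed_ppv_beta_le q (c : R) :
  closed ([set p | is_dist p /\ (ppv_beta eps W p q <= c%:E)%E]
    : set {ptws 'I_dA -> R}).
Proof.
pose F : set ({ptws 'I_dA -> R} * {ptws 'I_dA * 'I_dB -> R}) :=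
  ((@is_dist R 'I_dA : set {ptws 'I_dA -> R}) `*`
   [set N : {ptws 'I_dA * 'I_dB -> R} | forall k, 0 <= N k <= 1]) `&`
  ((\bigcap_(k in setT) [set pN | pN.2 k - pN.1 k.1 <= 0]) `&`
   ([set pN | 1 - eps <= \sum_k W k.1 k.2 * pN.2 k] `&`
    [set pN | \sum_k q k.2 * pN.2 k <= c])).
have c1 : continuous (fst : {ptws 'I_dA -> R} * {ptws 'I_dA * 'I_dB -> R} -> _).
  by move=> x; exact: cvg_fst.
have c2 : continuous (snd : {ptws 'I_dA -> R} * {ptws 'I_dA * 'I_dB -> R} -> _).
  by move=> x; exact: cvg_snd.
have clin (g : 'I_dA * 'I_dB -> R) :
    continuous (fun pN : {ptws 'I_dA -> R} * {ptws 'I_dA * 'I_dB -> R} =>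
      \sum_k g k * pN.2 k).
  move=> x; apply: (@continuous_comp _ _ _ snd
    (fun N : {ptws 'I_dA * 'I_dB -> R} => \sum_k g k * N k)).
    exact: c2.
  exact: continuous_lin.
have cF : compact F.
  apply: compact_closedI.
    by apply: compact_setX; [exact: compact_is_dist|exact: compact_cube].
  apply: closedI; last by apply: closedI; [exact: closed_fun_ge|exact: closed_fun_le].
  apply: closed_bigI => k _; apply: closed_fun_le => x.
  pose X : topologicalType := ({ptws 'I_dA -> R} * {ptws 'I_dA * 'I_dB -> R})%type.
  have cN : continuous (fun pN : X => pN.2 k : R^o).
    move=> y; apply: (@continuous_comp _ _ _ snd (fun N : {ptws _ -> R} => N k)).
      exact: c2.
    exact: (@proj_continuous _ (fun=> R) k).
  have cp : continuous (fun pN : X => pN.1 k.1 : R^o).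
    move=> y; apply: (@continuous_comp _ _ _ fst (fun p : {ptws _ -> R} => p k.1)).
      exact: c1.
    exact: (@proj_continuous _ (fun=> R) k.1).
  exact: (continuousB (cN x) (cp x)).
rewrite (_ : [set p | _] = fst @` F).
  apply: compact_closed; first exact: ptws_hausdorff.
  apply: continuous_compact => //; apply: continuous_subspaceT; exact: c1.
apply/seteqP; split=> [p [dp]|_ [[p N] FpN <-]].
  move=> /(ppv_beta_leP _ _ dp)[N [N0p HN Nc]].
  exists (p, N) => //; split; last first.
    by split; last split => //; move=> k _ /=; rewrite subr_le0; case/andP: (N0p k).
  split=> //= k; have /andP[-> /=] := N0p k.
  by move=> /le_trans; apply; exact: is_dist_le1.
move: FpN => [[/= dp N01] [Np [HN Nc]]]; split => //=.
apply/(ppv_beta_leP _ _ dp); exists N; split => // k.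
by have /andP[-> _] := N01 k; have := Np k I; rewrite /= subr_le0.
Qed.

Lemma ppv_attained : (0 < dA)%N ->
  exists2 p, is_dist p & ppv eps W = ppv_info eps W p.
Proof.
move=> dA0.
have cld : closed (@is_dist R 'I_dA : set {ptws 'I_dA -> R}).
  exact: compact_closed (@ptws_hausdorff _ _) (@compact_is_dist _ _).
have [||p dp maxp] := @compact_attains_min _ _ _ _
    (fun p : {ptws 'I_dA -> R} => - ppv_info eps W p)%E (@compact_is_dist R 'I_dA).
- by exists (fun x => (x == Ordinal dA0)%:R); exact: is_dist_point.
- move=> p dp.
  (* As an infimum over [q], the PPV information at [p'] is at least that at [p] iff every [q]
     satisfies a bound on beta, obtained by exponentiating. *)
  rewrite (_ : _ `&` _ = (@is_dist R 'I_dA : set {ptws 'I_dA -> R}) `&`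
    \bigcap_(q in @is_dist R 'I_dB) [set p' | is_dist p' /\
      (ppv_beta eps W p' q <= expeR (- ppv_info eps W p))%E]).
    apply: closedI => //; apply: closed_bigI => q dq.
    (* A threshold [+oo] imposes no condition, and [-oo] is excluded because exponentials are
       nonnegative. *)
    case E : (expeR _) => [c| |]; first exact: closed_ppv_beta_le.
      rewrite (_ : [set p' | _] = (@is_dist R 'I_dA : set {ptws 'I_dA -> R})) //.
      by apply/seteqP; split=> [p' []//|p' dp']; split => //; exact: leey.
    by have := expeR_ge0 (- ppv_info eps W p)%E; rewrite E.
  have lneP p' q : is_dist p' -> is_dist q ->
      (ppv_beta eps W p' q <= expeR (- ppv_info eps W p))%E =
      (ppv_info eps W p <= - lne (ppv_beta eps W p' q))%E.
    move=> dp' dq.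
    by rewrite -ge0_lee_lne ?ppv_beta_ge0 ?expeR_ge0 // expeRK [RHS]leeNr.
  apply/seteqP; split => p' [dp' /= H]; split => //.
    move=> q dq /=; split=> //; rewrite lneP //.
    have : (ppv_info eps W p <= ppv_info eps W p')%E by rewrite -leeN2.
    by move=> /le_trans; apply; apply: ereal_inf_lbound; exists q.
  rewrite /= leeN2; apply: le_ereal_inf_tmp => _ [q dq <-].
  by rewrite -lneP //; have [] := H q dq.
exists p => //; apply/eqP; rewrite eq_le; apply/andP; split.
  apply: ge_ereal_sup => _ [p' dp' <-]; rewrite -leeN2; exact: maxp.
by apply: ereal_sup_ubound; exists p.
Qed.

End PPV.

(** * Maps, tests and classical channels *)

Section Maps.
Import Order.TTheory GRing.Theory Num.Theory.
Local Open Scope ring_scope.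
Local Open Scope complex_scope.
Local Open Scope sesquilinear_scope.
Variable R : realType.
Local Notation C := R[i].

Lemma Re_real_mul (c : R) (z : C) : complex.Re (c%:C * z) = c * complex.Re z.
Proof. by case: z => a b /=; rewrite mul0r subr0. Qed.

Lemma ReD (x y : C) : complex.Re (x + y) = complex.Re x + complex.Re y.
Proof. by case: x; case: y. Qed.

Lemma Re_sum (I : Type) (r : seq I) (P : pred I) (F : I -> C) :
  complex.Re (\sum_(i <- r | P i) F i) = \sum_(i <- r | P i) complex.Re (F i).
Proof. exact: (big_morph (@complex.Re R) ReD). Qed.

Lemma Re_ge0 (z : C) : 0 <= z -> 0 <= complex.Re z.
Proof. by rewrite lecE => /andP[]. Qed.

Lemma Re_le (x y : C) : x <= y -> complex.Re x <= complex.Re y.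
Proof. by rewrite lecE => /andP[]. Qed.

Lemma ge0_ReK (z : C) : 0 <= z -> (complex.Re z)%:C = z.
Proof. by move=> /ger0_real /RRe_real. Qed.

Lemma psdE n (X : 'M[C]_n) : psd X = posmx X.
Proof. by []. Qed.

Lemma sum2_delta (V : pzRingType) (m n : nat) (F : 'I_m -> 'I_n -> V) a b :
  \sum_i \sum_j F i j * ((a == i) && (b == j))%:R = F a b.
Proof.
rewrite (bigD1 a) //= (bigD1 b) //= !eqxx mulr1 big1 ?addr0 => [|j /negPf nj].
  rewrite big1 ?addr0 // => i /negPf ni; apply: big1 => j _.
  by rewrite eq_sym ni mulr0.
by rewrite eq_sym nj mulr0.
Qed.

Lemma linear_matrixE m n (f : opmap R m n) (X : 'M[C]_m) a b : linear f ->
  f X a b = \sum_k \sum_l X k l * f (delta_mx k l) a b.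
Proof.
move=> lf.
have f0 : f 0 = 0 by have := lf (-1) 0 0; rewrite scaler0 addr0 scaleN1r addNr.
have fD : {morph f : Y Z / Y + Z} by move=> Y Z; have := lf 1 Y Z; rewrite !scale1r.
have fZ c Y : f (c *: Y) = c *: f Y by have := lf c Y 0; rewrite f0 !addr0.
rewrite {1}[X]matrix_sum_delta (big_morph f fD f0) summxE; apply: eq_bigr => k _.
rewrite (big_morph f fD f0) summxE; apply: eq_bigr => l _.
by rewrite fZ mxE.
Qed.

Lemma tensmapE (m n m' n' : nat) (F : opmap R m m') (D : opmap R n n') X i a j b :
  tensmap F D X (mxtens_index (i, a)) (mxtens_index (j, b)) =
  \sum_k \sum_l \sum_c \sum_d X (mxtens_index (k, c)) (mxtens_index (l, d)) *
     (F (delta_mx k l) i j * D (delta_mx c d) a b).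
Proof.
rewrite /tensmap summxE; apply: eq_bigr => k _; rewrite summxE; apply: eq_bigr => l _.
rewrite summxE; apply: eq_bigr => c _; rewrite summxE; apply: eq_bigr => d _.
by rewrite mxE tensmxE.
Qed.

Lemma tensmap_idE (k m n : nat) (f : opmap R m n) X i a j b : linear f ->
  tensmap (fun Y : 'M[C]_k => Y) f X (mxtens_index (i, a)) (mxtens_index (j, b)) =
  f (\matrix_(c, d) X (mxtens_index (i, c)) (mxtens_index (j, d))) a b.
Proof.
move=> lf; rewrite tensmapE linear_matrixE //.
rewrite -[RHS](sum2_delta (fun i j => \sum_c \sum_d (\matrix_(c, d)
  X (mxtens_index (i, c)) (mxtens_index (j, d))) c d * f (delta_mx c d) a b)).
apply: eq_bigr => i' _; apply: eq_bigr => j' _.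
rewrite mulr_suml; apply: eq_bigr => c _; rewrite mulr_suml; apply: eq_bigr => d _.
by rewrite !mxE; ring.
Qed.

Lemma mxtens_matrixP (T : Type) (m n m' n' : nat) (X Y : 'M[T]_(m * n, m' * n')) :
  (forall i a j b, X (mxtens_index (i, a)) (mxtens_index (j, b)) =
                   Y (mxtens_index (i, a)) (mxtens_index (j, b))) -> X = Y.
Proof.
by move=> XY; apply/matrixP => p q; case: (mxtens_indexP p) => i a;
  case: (mxtens_indexP q).
Qed.

Lemma sum_mxtens (V : nmodType) (m n : nat) (F : 'I_(m * n) -> V) :
  \sum_p F p = \sum_i \sum_a F (mxtens_index (i, a)).
Proof.
rewrite pair_bigA /= (reindex (@mxtens_index m n)) /=; first by apply: eq_bigr => -[].
by exists (@mxtens_unindex m n) => p _; rewrite ?mxtens_indexK ?mxtens_unindexK.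
Qed.

Lemma delta_diag_mx (V : pzRingType) n (x : 'I_n) :
  delta_mx x x = diag_mx (delta_mx 0 x) :> 'M[V]_n.
Proof.
apply/matrixP => i j; rewrite !mxE eqxx /=.
have [->|nij] := eqVneq i j; first by rewrite andbb.
have [ix|nix] := eqVneq i x; last by [].
by rewrite -ix eq_sym (negPf nij).
Qed.

Lemma dephaseE n (X : 'M[C]_n) a b : dephase X a b = X a b *+ (a == b).
Proof.
rewrite /dephase summxE.
have E (x : 'I_n) : (delta_mx x x *m X *m delta_mx x x) a b =
    (a == x)%:R * X a b * (b == x)%:R.
  rewrite delta_diag_mx.
  by rewrite mul_mx_diag mul_diag_mx !mxE !eqxx.
rewrite (bigD1 a) //= big1 => [|x /negPf nx]; last by rewrite E eq_sym nx !mul0r.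
by rewrite E eqxx mul1r addr0 mulr_natr eq_sym.
Qed.

Lemma dephase_linear n : linear (@dephase R n).
Proof.
by move=> c X Y; apply/matrixP => a b; rewrite !(dephaseE, mxE) mulrnDl mulrnAr.
Qed.

Lemma dephase_cptp n : cptp (@dephase R n).
Proof.
split=> [|k X psdX|X]; first exact: dephase_linear.
  (* Kraus form: a sum over [x] of congruences by the projections [1 (x) |x><x|]. *)
  rewrite [tensmap _ _ _](_ : _ = \sum_(x < n) \matrix_(p, q)
      ((((mxtens_unindex p).2 == x)%:R)^*%R * X (id p) (id q) *
        ((mxtens_unindex q).2 == x)%:R)).
    by apply: posmx_sum => x _; apply: posmx_reindex.
  apply: mxtens_matrixP => i a j b; rewrite tensmap_idE; last exact: dephase_linear.
  rewrite dephaseE mxE summxE; under eq_bigr do rewrite mxE !mxtens_indexK /=.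
  rewrite (bigD1 a) //= big1 => [|x /negPf nx].
    by rewrite eqxx rmorph1 mul1r addr0 mulr_natr eq_sym.
  by rewrite [a == x]eq_sym nx rmorph0 !mul0r.
by apply: eq_bigr => a _; rewrite dephaseE eqxx.
Qed.

Lemma tensmap_dephase m n (X : 'M[C]_(m * n)) :
  tensmap (@dephase R m) (@dephase R n) X = dephase X.
Proof.
apply: mxtens_matrixP => i a j b; rewrite tensmapE dephaseE.
under eq_bigr do under eq_bigr do under eq_bigr do under eq_bigr do rewrite !dephaseE !mxE.
rewrite (inj_eq (can_inj (@mxtens_indexK m n))) xpair_eqE.
pose G i' j' := \sum_c \sum_d X (mxtens_index (i', c)) (mxtens_index (j', d)) *
   ((i == j)%:R * (a == b)%:R) * ((a == c) && (b == d))%:R.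
transitivity (\sum_i' \sum_j' G i' j' * ((i == i') && (j == j'))%:R).
  apply: eq_bigr => i' _; apply: eq_bigr => j' _; rewrite /G mulr_suml.
  apply: eq_bigr => c _; rewrite mulr_suml; apply: eq_bigr => d _.
  by case: (i == j); case: (a == b); rewrite ?mulr1n ?mulr0n; ring.
rewrite sum2_delta /G (sum2_delta (fun c d =>
  X (mxtens_index (i, c)) (mxtens_index (j, d)) * ((i == j)%:R * (a == b)%:R))).
by rewrite -natrM mulnb mulr_natr.
Qed.

(** Complete positivity is used with a one-dimensional ancilla; the two reindexings pass between
    dimensions [m] and [1 * m], then back from [1 * n] to [n]. *)
Lemma cp_posmx m n (f : opmap R m n) (X : 'M[C]_m) :
  linear f -> completely_positive f -> psd X -> psd (f X).
Proof.
move=> lf cpf psdX.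
have pX1 := posmx_reindex (fun p => (@mxtens_unindex 1 m p).2) (fun=> 1) psdX.
have := posmx_reindex (fun a => mxtens_index (0 : 'I_1, a)) (fun=> 1) (cpf _ _ pX1).
rewrite psdE; congr posmx; apply/matrixP => a b.
rewrite mxE rmorph1 mul1r mulr1 tensmap_idE //; congr (f _ a b).
by apply/matrixP => c d; rewrite !mxE !mxtens_indexK mul1r mulr1.
Qed.

Lemma classical_testE m n (t : 'I_m -> 'I_n -> R) :
  \sum_(a < m) \sum_(b < n) (t a b)%:C *: (delta_mx a a *t delta_mx b b) =
  diag_mx (\row_p (t (mxtens_unindex p).1 (mxtens_unindex p).2)%:C).
Proof.
apply: mxtens_matrixP => i a j b.
rewrite summxE !mxE mxtens_indexK /=.
under eq_bigr do rewrite summxE.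
under eq_bigr do under eq_bigr do rewrite mxE tensmxE !mxE.
rewrite (inj_eq (can_inj (@mxtens_indexK m n))) xpair_eqE.
rewrite -[RHS]mulr_natr -[RHS](sum2_delta (fun x y => (t x y)%:C *
  ((i == j) && (a == b))%:R)).
apply: eq_bigr => x _; apply: eq_bigr => y _.
rewrite -!mulrA; congr (_ * _); rewrite -!natrM !mulnb; congr (_%:R).
have [->|nix] := eqVneq i x; last by rewrite andbF.
have [->|nay] := eqVneq a y; last by rewrite !andbF.
by rewrite /= !andbT [j == x]eq_sym [b == y]eq_sym.
Qed.

Lemma mxtrace_mul_diag n (X : 'M[C]_n) (d : 'rV[C]_n) :
  \tr (X *m diag_mx d) = \sum_p X p p * d 0 p.
Proof. by apply: eq_bigr => p _; rewrite mul_mx_diag mxE. Qed.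

(* Moving the positive map from the test to the state reduces the test to a diagonal
   one with entries in [0, 1]. *)
Lemma tests_bounds (Om : opclass R) (tdiag : bool) m n (T V : 'M[C]_(m * n)) :
  is_opclass Om -> tests Om tdiag T -> psd V -> 0 <= \tr (V *m T) <= \tr V.
Proof.
move=> HOm [_ [m' [n' [t [f [t01 Omf _ ->]]]]]] psdV.
have [lf cpf tpf] := HOm _ _ _ _ _ Omf.
rewrite classical_testE; set D := diag_mx _.
have pfV : psd (f V) by apply: cp_posmx.
(* [adjoint_map] conjugates the values of [f]. Since [V] and [f V] are Hermitian, both may be
   replaced by their conjugate transposes before expanding over matrix units. *)
have -> : \tr (V *m adjoint_map f D) = \tr (f V *m D).
  rewrite -[in RHS](posmx_herm pfV) -[in RHS](posmx_herm psdV).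
  have -> : (f (V ^t* )) ^t* = \sum_p \sum_q V p q *: (f (delta_mx q p)) ^t*.
    apply/matrixP => k l; rewrite summxE 2!mxE linear_matrixE // exchange_big.
    rewrite rmorph_sum; apply: eq_bigr => p _.
    rewrite summxE rmorph_sum; apply: eq_bigr => q _.
    by rewrite !mxE rmorphM /= conjCK.
  rewrite mulmx_suml raddf_sum; apply: eq_bigr => p _.
  rewrite mxE mulmx_suml raddf_sum; apply: eq_bigr => q _.
  by rewrite mxE -scalemxAl /= mxtraceZ.
rewrite mxtrace_mul_diag -tpf sumr_ge0 /= => [|p _].
  apply: ler_sum => p _; rewrite mxE -[leRHS]mulr1 ler_wpM2l ?posmx_diag_ge0 //.
  by rewrite lecR; case/andP: (t01 (mxtens_unindex p).1 (mxtens_unindex p).2).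
rewrite mxE mulr_ge0 ?posmx_diag_ge0 // ler0c.
by case/andP: (t01 (mxtens_unindex p).1 (mxtens_unindex p).2).
Qed.
End Maps.

(** * Classical channels: entries of the two hypotheses *)

Section ClassicalChannels.
Import Order.TTheory GRing.Theory Num.Theory.
Local Open Scope ring_scope.
Local Open Scope complex_scope.
Local Open Scope sesquilinear_scope.
Variables (R : realType) (dA dB : nat) (E : opmap R dA dB).
Local Notation C := R[i].
Hypothesis hE : classical_channel E.
Local Notation W := (transition E).

Lemma delta_diag_psd n (x : 'I_n) : psd (delta_mx x x : 'M[C]_n).
Proof.
by rewrite delta_diag_mx; apply: posmx_diag_mx => i; rewrite mxE ler0n.
Qed.

Lemma transition_dist x : is_dist (W x).
Proof.
have [[lE cpE tE] _ _] := hE.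
have pE : psd (E (delta_mx x x)) by apply: cp_posmx => //; exact: delta_diag_psd.
split=> [y|]; first by apply: Re_ge0; exact: posmx_diag_ge0.
rewrite /transition -Re_sum -[\sum_k _]/(\tr (E (delta_mx x x))) tE.
rewrite delta_diag_mx mxtrace_diag (bigD1 x) //= big1 => [|y /negPf ny].
  by rewrite mxE !eqxx addr0.
by rewrite mxE ny andbF.
Qed.

(** Dephasing the input removes the off-diagonal entries of [X], and dephasing the output leaves
    only [a = b]. The remaining coefficients are nonnegative, so they equal their real parts
    [W x a]. *)
Lemma channelE (X : 'M[C]_dA) a b :
  E X a b = (\sum_x (W x a)%:C * X x x) *+ (a == b).
Proof.
have [[lE cpE tE] EC CE] := hE.
have pE x : psd (E (delta_mx x x)) by apply: cp_posmx => //; exact: delta_diag_psd.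
have dephase_delta i j :
    dephase (delta_mx i j) = (i == j)%:R *: delta_mx i i :> 'M[C]_dA.
  apply/matrixP => k l; rewrite dephaseE !mxE.
  have [->|nij] := eqVneq i j; have [->|nkl] := eqVneq k l.
  - by rewrite mul1r.
  - rewrite mul1r mulr0n; case: eqP => //= kj; case: eqP => //= lj.
    by rewrite kj lj eqxx in nkl.
  - rewrite mul0r mulr1n; case: eqP => //= li; case: eqP => //= lj.
    by rewrite -li -lj eqxx in nij.
  - by rewrite mul0r mulr0n.
have E0 : E 0 = 0 by have := lE (-1) 0 0; rewrite scaler0 addr0 scaleN1r addNr.
have EZ c Y : E (c *: Y) = c *: E Y by have := lE c Y 0; rewrite E0 !addr0.
rewrite -CE dephaseE; have [<-|//] := eqVneq a b.
congr (_ *+ _); rewrite linear_matrixE //.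
apply: eq_bigr => x _; rewrite (bigD1 x) //= big1 => [|j /negPf nj].
  rewrite addr0 -(ge0_ReK (posmx_diag_ge0 a (pE x))).
  exact: mulrC.
by rewrite -EC dephase_delta eq_sym nj scale0r E0 mxE mulr0.
Qed.

Lemma sqrt_mxP n (rho : 'M[C]_n) : psd rho ->
  psd (sqrt_mx rho) /\ sqrt_mx rho *m sqrt_mx rho = rho.
Proof.
move=> /posmx_sqrt_ex[S pS SS]; rewrite /sqrt_mx.
by case: xgetP => [_ -> //|/(_ S)]; case; split.
Qed.

Lemma purifE n (rho : 'M[C]_n) i k j l :
  purif rho (mxtens_index (i, k)) (mxtens_index (j, l)) =
  sqrt_mx rho k i * sqrt_mx rho j l.
Proof.
set S := sqrt_mx rho; rewrite /purif -/S /Phi mulmx_sumr mulmx_suml summxE.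
rewrite -[RHS](sum2_delta (fun i j => S k i * S j l)).
apply: eq_bigr => x _; rewrite mulmx_sumr mulmx_suml summxE; apply: eq_bigr => y _.
rewrite !tensmx_mul tensmxE mul1mx mulmx1 mxE.
(* [|x><y|] factors through dimension 1, so [S |x><y| S] is a column of [S] times a row of [S]. *)
rewrite mulrC; congr (_ * _); rewrite -(mul_delta_mx (0 : 'I_1)) mulmxA -colE.
by rewrite -mulmxA -rowE mxE big_ord1 !mxE.
Qed.

(* The operator u u^* with u = (row x of rho^(1/2))^T (x) |y>. *)
Definition test_vec_proj n m (rho : 'M[C]_n) (k : 'I_n * 'I_m) : 'M[C]_(n * m) :=
  \matrix_(p, q)
    (sqrt_mx rho k.1 (mxtens_unindex p).1 * sqrt_mx rho (mxtens_unindex q).1 k.1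
     * ((mxtens_unindex p).2 == k.2)%:R * ((mxtens_unindex q).2 == k.2)%:R).

Lemma test_vec_projE n m (rho : 'M[C]_n) x (y : 'I_m) i a j b :
  test_vec_proj rho (x, y) (mxtens_index (i, a)) (mxtens_index (j, b)) =
  sqrt_mx rho x i * sqrt_mx rho j x * ((y == a) && (y == b))%:R.
Proof.
by rewrite mxE !mxtens_indexK /= -mulrA -natrM mulnb ![_ == y]eq_sym.
Qed.

Lemma test_vec_proj_psd n m (rho : 'M[C]_n) (k : 'I_n * 'I_m) :
  psd rho -> psd (test_vec_proj rho k).
Proof.
move=> /sqrt_mxP[pS _].
(* The rank-one operator arises by reindexing the 1 by 1 matrix with entry 1; Hermiticity of the
   root absorbs the conjugate. *)
have := posmx_reindex (fun=> 0 : 'I_1) (fun p : 'I_(n * m) =>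
  sqrt_mx rho (mxtens_unindex p).1 k.1 * ((mxtens_unindex p).2 == k.2)%:R)
  (@posmx_diag_mx _ _ (const_mx 1) (fun i => eq_ind_r (fun z => 0 <= z) ler01 (mxE _ _ _ _))).
rewrite psdE; congr posmx; apply/matrixP => p q; rewrite !mxE.
rewrite rmorphM rmorph_nat (posmx_hermE k.1 _ pS) /=.
by ring.
Qed.

Lemma test_vec_proj_tr n m (rho : 'M[C]_n) (k : 'I_n * 'I_m) :
  psd rho -> \tr (test_vec_proj rho k) = rho k.1 k.1.
Proof.
case: k => x y /sqrt_mxP[_ SS]; rewrite /mxtrace sum_mxtens -[in RHS]SS mxE.
apply: eq_bigr => i _; under eq_bigr do rewrite test_vec_projE.
rewrite (bigD1 y) //= big1 => [|a /negPf na]; first by rewrite eqxx mulr1 addr0.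
by rewrite eq_sym na mulr0.
Qed.

Lemma joint_stateE (rho : 'M[C]_dA) :
  joint_state E rho = \sum_k (W k.1 k.2)%:C *: test_vec_proj rho k.
Proof.
have [[lE _ _] _ _] := hE.
apply: mxtens_matrixP => i a j b; rewrite tensmap_idE // channelE summxE sum_pairE.
rewrite -mulr_natr mulr_suml; apply: eq_bigr => x _ /=.
under eq_bigr do rewrite mxE test_vec_projE.
rewrite mxE purifE (bigD1 a) //= eqxx big1 => [|y /negPf ny].
  by rewrite addr0 !mulrA.
by rewrite ny !mulr0.
Qed.

Lemma ptrace2_purifE (rho : 'M[C]_dA) i j :
  ptrace2 (purif rho) i j = \sum_x sqrt_mx rho x i * sqrt_mx rho j x.
Proof. by rewrite mxE; apply: eq_bigr => x _; rewrite purifE. Qed.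

Lemma diag_stateE n (q : 'I_n -> R) a b : diag_state q a b = (q a)%:C *+ (a == b).
Proof.
rewrite /diag_state summxE (bigD1 a) //= big1 => [|x /negPf nx].
  by rewrite !mxE eqxx /= addr0 mulr_natr eq_sym.
by rewrite !mxE eq_sym nx mulr0.
Qed.

Lemma product_stateE (rho : 'M[C]_dA) (q : 'I_dB -> R) :
  product_state rho (diag_state q) = \sum_k (q k.2)%:C *: test_vec_proj rho k.
Proof.
apply: mxtens_matrixP => i a j b; rewrite tensmxE ptrace2_purifE diag_stateE summxE sum_pairE.
rewrite mulr_suml; apply: eq_bigr => x _ /=.
under eq_bigr do rewrite mxE test_vec_projE.
rewrite (bigD1 a) //= eqxx big1 => [|y /negPf ny].
  by rewrite addr0 mulr_natr !mulrnAr /=; congr (_ *+ _); exact: mulrC.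
by rewrite ny !mulr0.
Qed.


Lemma Re_tr_test_sum n (K : finType) (c : K -> R) (V : K -> 'M[C]_n) T :
  complex.Re (\tr ((\sum_k (c k)%:C *: V k) *m T)) =
  \sum_k c k * complex.Re (\tr (V k *m T)).
Proof.
transitivity (complex.Re (\sum_k (c k)%:C * \tr (V k *m T))).
  congr complex.Re; rewrite mulmx_suml raddf_sum; apply: eq_bigr => k _.
  by rewrite -scalemxAl /= mxtraceZ.
by rewrite Re_sum; apply: eq_bigr => k _; rewrite Re_real_mul.
Qed.

Lemma density_dist n (rho : 'M[C]_n) : density rho ->
  is_dist (fun x => complex.Re (rho x x)).
Proof.
move=> [prho trho]; split=> [x|]; first by apply: Re_ge0; exact: posmx_diag_ge0.
by rewrite -Re_sum -[\sum_k _]/(\tr rho) trho.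
Qed.

Lemma dephase_diag_state n (rho : 'M[C]_n) : psd rho ->
  dephase rho = diag_state (fun x => complex.Re (rho x x)).
Proof.
move=> prho; apply/matrixP => a b; rewrite dephaseE diag_stateE.
by have [->|//] := eqVneq a b; rewrite ge0_ReK // posmx_diag_ge0.
Qed.

Lemma diag_state_diag_mx n (q : 'I_n -> R) :
  diag_state q = diag_mx (\row_x (q x)%:C).
Proof. by apply/matrixP => a b; rewrite diag_stateE !mxE. Qed.

Lemma diag_state_density n (q : 'I_n -> R) : is_dist q -> density (diag_state q).
Proof.
move=> [q0 q1]; rewrite diag_state_diag_mx; split.
  by apply: posmx_diag_mx => i; rewrite mxE ler0c.
rewrite mxtrace_diag; under eq_bigr do rewrite mxE.
by rewrite -rmorph_sum q1.
Qed.

Lemma diag_state_is_diag n (q : 'I_n -> R) : is_diag_mx (diag_state q).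
Proof. by rewrite diag_state_diag_mx diag_mx_is_diag. Qed.

(** * Comparison of quantum and classical tests *)

Variable eps : R.
Implicit Type Om : opclass R.

Lemma ppv_beta_le_beta Om (tdiag : bool) (rho : 'M[C]_dA) q :
  is_opclass Om -> psd rho ->
  (ppv_beta eps W (fun x => complex.Re (rho x x)) q <=
   beta Om tdiag eps (joint_state E rho) (product_state rho (diag_state q)))%E.
Proof.
move=> HOm prho; apply: le_ereal_inf_tmp => _ [T [testT HT] <-].
move: HT; rewrite joint_stateE product_stateE !Re_tr_test_sum => HT.
(* The candidate is [N k = Tr (test_vec_proj rho k) T], bounded by the trace of that operator, a
   diagonal entry of [rho]. *)
apply: (ppv_beta_le q) HT => k.
have /andP[V0 V1] := tests_bounds HOm testT (test_vec_proj_psd k prho).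
rewrite Re_ge0 //=; apply: le_trans (Re_le V1) _.
by rewrite test_vec_proj_tr.
Qed.

Lemma info_le_ppv_info Om (sdiag tdiag : bool) (rho : 'M[C]_dA) :
  is_opclass Om -> psd rho ->
  (info Om sdiag tdiag eps E rho <=
   ppv_info eps W (fun x => complex.Re (rho x x)))%E.
Proof.
move=> HOm prho; apply: le_ereal_inf_tmp => _ [q dq <-].
apply: le_trans (_ : (- lne (beta Om tdiag eps (joint_state E rho)
  (product_state rho (diag_state q))) <= _)%E); last first.
  by rewrite leeN2 le_lne // ppv_beta_le_beta.
apply: ereal_inf_lbound; exists (diag_state q) => //; split.
  exact: diag_state_density.
by move=> _; exact: diag_state_is_diag.
Qed.

(** The measuring map is joint dephasing. It is a product of local dephasings, hence in [class_L]
    with a single value of the shared randomness, and its adjoint fixes every diagonal operator. *)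
Lemma classical_tests Om (tdiag : bool) (t : 'I_dA * 'I_dB -> R) :
  Om = @class_ALL R \/ subclass (@class_L R) Om ->
  (forall k, 0 <= t k <= 1) ->
  tests Om tdiag (diag_mx (\row_p (t (mxtens_unindex p))%:C) : 'M[C]_(dA * dB)).
Proof.
move=> HOm t01; split=> [_|]; first exact: diag_mx_is_diag.
exists dA, dB, (fun a b => t (a, b)), (@dephase R (dA * dB)); split.
- by move=> a b; exact: t01.
- case: HOm => [->|LOm]; first exact: dephase_cptp.
  apply: LOm; exists 1%N, (fun=> 1), (fun=> @dephase R dA), (fun=> @dephase R dB).
  split; [|by move=> _; exact: dephase_cptp|by move=> _; exact: dephase_cptp|].
    by split=> [_|]; rewrite ?ler01 // big_ord1.
  by move=> X; rewrite big_ord1 scale1r tensmap_dephase.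
- move=> X; apply/is_diag_mxP => i j nij; rewrite dephaseE.
  by have [ij|//] := eqVneq i j; rewrite ij eqxx in nij.
rewrite classical_testE; apply/matrixP => p q; rewrite [RHS]mxE mxtrace_mul_diag !mxE.
under eq_bigr do rewrite !mxE dephaseE eqxx mulr1n mxE rmorph_nat -surjective_pairing.
have [<-|npq] := eqVneq p q.
  rewrite (bigD1 p) //= big1 => [|k /negPf nk]; first by rewrite !eqxx mul1r addr0.
  by rewrite nk mul0r.
rewrite big1 // => k _; case: eqP => [->|_] /=; last by rewrite mul0r.
by rewrite (negPf npq) mul0r.
Qed.

Lemma sqrt_diag_state p : is_dist p ->
  sqrt_mx (diag_state p) = diag_mx (\row_x sqrtC (p x)%:C) :> 'M[C]_dA.
Proof.
move=> dp; have [[pr _] p0] := (diag_state_density dp, dp.1).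
have [pS SS] := sqrt_mxP pr; rewrite [RHS]diag_state_diag_mx in SS.
rewrite (posmx_sqrt_diag _ pS SS) => [|i]; last by rewrite mxE ler0c.
by congr diag_mx; apply/rowP => i; rewrite !mxE.
Qed.

(** The root is diagonal here, so the vector [u] is [sqrt (p x) |x>|y>] and both mixtures become
    classical distributions when [sigma] is diagonal. *)
Lemma test_vec_proj_diag_state p (k : 'I_dA * 'I_dB) : is_dist p ->
  test_vec_proj (diag_state p) k =
  (p k.1)%:C *: delta_mx (mxtens_index k) (mxtens_index k).
Proof.
move=> dp; case: k => x y; apply: mxtens_matrixP => i a j b.
rewrite test_vec_projE sqrt_diag_state // !mxE.
rewrite !(inj_eq (can_inj (@mxtens_indexK dA dB))) !xpair_eqE /=.
have [xi|_] := eqVneq x i; last by rewrite mulr0n !mul0r mulr0.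
have [jx|_] := eqVneq j x; last by rewrite mulr0n mulr0 mul0r andbF mulr0.
by rewrite jx !mulr1n -expr2 sqrtCK /= [a == y]eq_sym [b == y]eq_sym.
Qed.

(** A diagonal test sees only the diagonal of the product state, so an arbitrary [sigma] acts as the
    distribution on its diagonal. *)
Lemma beta_le_ppv_beta Om (tdiag : bool) p (sigma : 'M[C]_dB) :
  Om = @class_ALL R \/ subclass (@class_L R) Om -> is_dist p -> psd sigma ->
  (beta Om tdiag eps (joint_state E (diag_state p)) (product_state (diag_state p) sigma)
   <= ppv_beta eps W p (fun y => complex.Re (sigma y y)))%E.
Proof.
move=> HOm dp psig; apply: le_ereal_inf_tmp => _ [t [t01 Ht] <-].
apply: ereal_inf_lbound; set T : 'M[C]_(dA * dB) :=
  diag_mx (\row_p (t (mxtens_unindex p))%:C).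
exists T; first split.
- exact: classical_tests.
- apply: le_trans Ht _; rewrite joint_stateE Re_tr_test_sum.
  rewrite le_eqVlt; apply/orP; left; apply/eqP; apply: eq_bigr => k _.
  rewrite test_vec_proj_diag_state // -scalemxAl mxtraceZ Re_real_mul mxtrace_mul_diag.
  rewrite (bigD1 (mxtens_index k)) //= big1 => [|l /negPf nl]; last first.
    by rewrite !mxE nl mul0r.
  by rewrite !mxE mxtens_indexK eqxx mul1r addr0 /joint_dist mulrA [W _ _ * _]mulrC.
congr (_%:E); rewrite mxtrace_mul_diag sum_mxtens sum_pairE Re_sum.
apply: eq_bigr => x _; rewrite Re_sum; apply: eq_bigr => y _.
rewrite tensmxE ptrace2_purifE mxE mxtens_indexK.
have [pr _] := diag_state_density dp; have [_ SS] := sqrt_mxP pr.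
have -> : \sum_z sqrt_mx (diag_state p) z x * sqrt_mx (diag_state p) x z = (p x)%:C.
  transitivity (diag_state p x x); last by rewrite diag_stateE eqxx.
  by rewrite -[in RHS]SS mxE; apply: eq_bigr => z _; exact: mulrC.
by rewrite -(ge0_ReK (posmx_diag_ge0 y psig)) -!rmorphM.
Qed.

Lemma info_diag_state Om (sdiag tdiag : bool) p :
  is_opclass Om -> Om = @class_ALL R \/ subclass (@class_L R) Om -> is_dist p ->
  info Om sdiag tdiag eps E (diag_state p) = ppv_info eps W p.
Proof.
move=> HOm LOm dp; have [pr _] := diag_state_density dp.
apply/eqP; rewrite eq_le; apply/andP; split.
  apply: le_trans (info_le_ppv_info sdiag tdiag HOm pr) _.
  rewrite le_eqVlt; apply/orP; left; apply/eqP; congr (ppv_info _ _ _).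
  by apply/funext => x; rewrite diag_stateE eqxx.
apply: le_ereal_inf_tmp => _ [sigma [[psig trsig] _] <-].
apply: le_trans (_ : (- lne (ppv_beta eps W p (fun y => complex.Re (sigma y y))) <= _)%E).
  by apply: ereal_inf_lbound; exists (fun y => complex.Re (sigma y y)) => //; exact: density_dist.
by rewrite leeN2 le_lne // beta_le_ppv_beta.
Qed.

Lemma beta_diag_state Om (tdiag : bool) p q :
  is_opclass Om -> Om = @class_ALL R \/ subclass (@class_L R) Om ->
  is_dist p -> is_dist q ->
  beta Om tdiag eps (joint_state E (diag_state p))
    (product_state (diag_state p) (diag_state q)) = ppv_beta eps W p q.
Proof.
move=> HOm LOm dp dq; have [pr _] := diag_state_density dp.
have [qr _] := diag_state_density dq.
have diagK n (f : 'I_n -> R) : (fun x => complex.Re (diag_state f x x)) = f.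
  by apply/funext => x; rewrite diag_stateE eqxx.
apply/eqP; rewrite eq_le; apply/andP; split.
  by have := beta_le_ppv_beta tdiag LOm dp qr; rewrite diagK.
by have := ppv_beta_le_beta tdiag q HOm pr; rewrite diagK.
Qed.

Lemma max_info_ppv Om (rdiag sdiag tdiag : bool) :
  is_opclass Om -> Om = @class_ALL R \/ subclass (@class_L R) Om ->
  max_info Om rdiag sdiag tdiag eps E = ppv eps W.
Proof.
move=> HOm LOm; apply/eqP; rewrite eq_le; apply/andP; split.
  apply: ge_ereal_sup => _ [rho [drho _] <-].
  apply: le_trans (info_le_ppv_info sdiag tdiag HOm drho.1) _.
  apply: ereal_sup_ubound; exists (fun x => complex.Re (rho x x)) => //.
  exact: density_dist.
apply: ge_ereal_sup => _ [p dp <-]; apply: ereal_sup_ubound.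
exists (diag_state p); last exact: info_diag_state.
split; first exact: diag_state_density.
by move=> _; exact: diag_state_is_diag.
Qed.

End ClassicalChannels.

(** * Codes *)

Section Codes.
Import Order.TTheory GRing.Theory Num.Theory.
Local Open Scope ring_scope.
Local Open Scope complex_scope.
Local Open Scope sesquilinear_scope.
Variables (R : realType) (dA dB : nat) (E : opmap R dA dB) (eps : R).
Local Notation C := R[i].
Hypothesis hE : classical_channel E.
Local Notation W := (transition E).

Section OneCode.
Variables (M dAE dBE : nat) (c : ea_code R M dA dB dAE dBE).
Hypothesis hc : is_ea_code c.

(** Joint state of the receiver's share and the channel input when [w] is sent. *)
Let tau (w : 'I_M) : 'M[C]_(dBE * dA) :=
  tensmap (fun Y : 'M[C]_dBE => Y) (code_enc c w) (code_state c).

(* (<x| tau |x>) (x) |y><y| *)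
Let Z (w : 'I_M) (k : 'I_dA * 'I_dB) : 'M[C]_(dBE * dB) :=
  \matrix_(P, Q) (((mxtens_unindex P).2 == k.2)%:R^*%R *
    tau w (mxtens_index ((mxtens_unindex P).1, k.1))
          (mxtens_index ((mxtens_unindex Q).1, k.1)) *
    ((mxtens_unindex Q).2 == k.2)%:R).

Let ZE w x y i a j b :
  Z w (x, y) (mxtens_index (i, a)) (mxtens_index (j, b)) =
  tau w (mxtens_index (i, x)) (mxtens_index (j, x)) * ((a == y) && (b == y))%:R.
Proof.
rewrite mxE !mxtens_indexK /= rmorph_nat mulrAC -natrM mulnb; exact: mulrC.
Qed.

Let enc_cptp w : cptp (code_enc c w). Proof. by case: hc => _ + _ _; apply. Qed.

Let tau_psd w : psd (tau w).
Proof.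
have [[ps _] _ _ _] := hc; have [_ cpC _] := enc_cptp w; exact: cpC.
Qed.

Let Z_psd w k : psd (Z w k).
Proof. by apply: posmx_reindex; exact: tau_psd. Qed.

(** No signalling: the encoder preserves the trace, so the receiver's marginal is the same for all
    [w]. *)
Let tau_tr w i j :
  \sum_x tau w (mxtens_index (i, x)) (mxtens_index (j, x)) =
  ptrace2 (code_state c) i j.
Proof.
have [lC _ tC] := enc_cptp w; rewrite mxE.
under eq_bigr do rewrite tensmap_idE //.
rewrite -[LHS]/(\tr (code_enc c w _)) tC; apply: eq_bigr => x _.
by rewrite mxE.
Qed.

Let tr_ptrace2 : \sum_i ptrace2 (code_state c) i i = 1.
Proof.
have [[_ <-] _ _ _] := hc; rewrite [RHS]sum_mxtens.
by apply: eq_bigr => i _; rewrite mxE.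
Qed.

(** Distribution of the channel input, read in the classical basis, when [w] is sent. *)
Let p_ w x : R := complex.Re (\sum_i tau w (mxtens_index (i, x)) (mxtens_index (i, x))).

Let p_dist w : is_dist (p_ w).
Proof.
split=> [x|].
  by apply: Re_ge0; apply: sumr_ge0 => i _; apply: posmx_diag_ge0; exact: tau_psd.
rewrite /p_ -Re_sum exchange_big /=.
by under eq_bigr do rewrite tau_tr; rewrite tr_ptrace2.
Qed.

Let Z_tr w k : complex.Re (\tr (Z w k)) = p_ w k.1.
Proof.
case: k => x y; congr complex.Re; rewrite /mxtrace sum_mxtens; apply: eq_bigr => i _.
under eq_bigr do rewrite ZE andbb.
rewrite (bigD1 y) //= eqxx mulr1 big1 ?addr0 // => a /negPf na.
by rewrite na mulr0.
Qed.

Let receivedE w :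
  tensmap (fun Y : 'M[C]_dBE => Y) (fun X => E (code_enc c w X)) (code_state c) =
  \sum_k (W k.1 k.2)%:C *: Z w k.
Proof.
have [[lE _ _] _ _] := hE; have [lC _ _] := enc_cptp w.
apply: mxtens_matrixP => i a j b.
rewrite tensmap_idE; last by move=> r X Y; rewrite lC lE.
rewrite channelE // summxE sum_pairE -mulr_natr mulr_suml; apply: eq_bigr => x _.
under eq_bigr do rewrite mxE ZE.
rewrite (bigD1 a) //= big1 => [|y /negPf ny]; last by rewrite eq_sym ny !mulr0.
by rewrite eqxx addr0 -tensmap_idE // mulrA [b == a]eq_sym.
Qed.

Let D := code_dec c.

(** Probability, when [w] is sent, that the channel input reads [x] and the decoder, handed the
    output [y], announces [w']. *)
Let pr w w' k := complex.Re (\tr (Z w k *m D w')).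

Let pr_ge0 w w' k : 0 <= pr w w' k.
Proof.
have [_ _ pD _] := hc.
apply: Re_ge0; rewrite mxtrace_mulC.
exact: posmx_tr_mul_ge0 (pD w') (Z_psd w k).
Qed.

Let pr_sum w k : \sum_w' pr w w' k = p_ w k.1.
Proof.
have [_ _ _ D1] := hc.
rewrite -Z_tr -Re_sum; congr complex.Re.
by rewrite -[in RHS](mulmx1 (Z w k)) -D1 mulmx_sumr [RHS]raddf_sum.
Qed.

Let code_probE w w' : code_prob E c w w' = \sum_k W k.1 k.2 * pr w w' k.
Proof. by rewrite /code_prob mxtrace_mulC receivedE Re_tr_test_sum. Qed.

Let code_prob_sum w : \sum_w' code_prob E c w w' = 1.
Proof.
under eq_bigr do rewrite code_probE.
rewrite exchange_big /= -(p_dist w).2 sum_pairE; apply: eq_bigr => x _ /=.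
under eq_bigr do rewrite -mulr_sumr pr_sum /=.
by rewrite -mulr_suml (transition_dist hE x).2 mul1r.
Qed.

Let code_errorE : (0 < M)%N ->
  code_error E c = 1 - M%:R^-1 * \sum_w code_prob E c w w.
Proof.
move=> M0; rewrite /code_error.
transitivity (M%:R^-1 * \sum_w (1 - code_prob E c w w)).
  congr (_ * _); apply: eq_bigr => w _; rewrite -(code_prob_sum w).
  by rewrite [in RHS](bigD1 w) //= addrAC subrr add0r.
rewrite sumrB mulrBr sumr_const card_ord mulVf // pnatr_eq0 -lt0n //.
Qed.

(** Summing over [x] traces out the channel input; what is left depends on [w'] and [y] but not on
    [w]. *)
Let tr_partial w w' y :
  \sum_x pr w w' (x, y) =
  complex.Re (\tr ((ptrace2 (code_state c) *t delta_mx y y) *m D w')).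
Proof.
rewrite /pr -Re_sum; congr complex.Re.
rewrite -raddf_sum -mulmx_suml; congr (\tr (_ *m _)).
apply: mxtens_matrixP => i a j b; rewrite summxE tensmxE -(tau_tr w) mulr_suml.
by apply: eq_bigr => x _; rewrite ZE mxE.
Qed.

Let tr_partial_sum w y : \sum_w' \sum_x pr w w' (x, y) = 1.
Proof.
rewrite exchange_big /=; under eq_bigr do rewrite pr_sum.
exact: (p_dist w).2.
Qed.

(* The code is itself a test: T(x, y) is the probability of decoding the message sent,
   given channel input x and output y. Under p x q it succeeds with probability
   1 / M, because the receiver then holds nothing that depends on the message. *)
Lemma code_ppv_beta : (0 < M)%N -> code_error E c <= eps ->
  exists2 p, is_dist p & forall q, is_dist q ->
    (ppv_beta eps W p q <= (M%:R^-1)%:E)%E.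
Proof.
move=> M0; have M1 : (M%:R : R) != 0 by rewrite pnatr_eq0 -lt0n.
have Mi0 : 0 <= (M%:R : R)^-1 by rewrite invr_ge0.
rewrite code_errorE // => err.
(* The input distribution is averaged over the equiprobable messages, and [N] below is the matching
   average of correct decodings. *)
exists (fun x => M%:R^-1 * \sum_w p_ w x) => [|q dq].
  split=> [x|]; first by rewrite mulr_ge0 // sumr_ge0 // => w _; exact: (p_dist w).1.
  rewrite -mulr_sumr exchange_big /=; under eq_bigr do rewrite (p_dist _).2.
  by rewrite sumr_const card_ord mulVf.
have := @ppv_beta_le R dA dB W eps (fun x => M%:R^-1 * \sum_w p_ w x) q
  (fun k => M%:R^-1 * \sum_w pr w w k).
have -> : \sum_k q k.2 * (M%:R^-1 * \sum_w pr w w k) = M%:R^-1.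
  have w0 : 'I_M := Ordinal M0.
  transitivity (M%:R^-1 * \sum_y q y * \sum_w \sum_x pr w w (x, y)).
    rewrite sum_pairE exchange_big mulr_sumr; apply: eq_bigr => y _.
    by rewrite [in RHS]exchange_big /= mulrCA !mulr_sumr; apply: eq_bigr.
  under eq_bigr => y _.
    rewrite (_ : \sum_w _ = 1).
      rewrite mulr1. over.
    (* By [tr_partial] the message sent may be replaced by a fixed [w0]; the outcomes of one POVM
       then sum to 1. *)
    rewrite -(tr_partial_sum w0 y); apply: eq_bigr => w _.
    exact: etrans (tr_partial w w y) (esym (tr_partial w0 w y)).
  by rewrite dq.2 mulr1.
apply=> [k|].
  rewrite mulr_ge0 ?sumr_ge0 //= ler_wpM2l // ler_sum // => w _.
  by rewrite -pr_sum (bigD1 w) //= lerDl sumr_ge0.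
have -> : \sum_k W k.1 k.2 * (M%:R^-1 * \sum_w pr w w k) =
    M%:R^-1 * \sum_w code_prob E c w w.
  under [in RHS]eq_bigr do rewrite code_probE.
  rewrite exchange_big mulr_sumr; apply: eq_bigr => k _.
  by rewrite mulrCA -mulr_sumr.
by move: err; set s := _ * _; lra.
Qed.

End OneCode.

(** One [p] serves every [q], so the bound passes first to the infimum over [q] and then to the
    supremum over [p]. *)
Lemma achievable_ppv dAE dBE M :
  achievable eps E dAE dBE M -> (lne (M%:R : R)%:E <= ppv eps W)%E.
Proof.
move=> [M0 [c [hc err]]]; have [p dp Hp] := code_ppv_beta hc M0 err.
apply: le_trans (_ : (ppv_info eps W p <= _)%E); last first.
  by apply: ereal_sup_ubound; exists p.
apply: le_ereal_inf_tmp => _ [q dq <-].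
by rewrite leeNr -lneV ?ltr0n // le_lne ?Hp.
Qed.

Lemma max_size_EA_ppv : (lne (max_size_EA eps E) <= ppv eps W)%E.
Proof.
(* Exponentiating the right side reduces the claim to a bound on each size separately. *)
rewrite -[leRHS]expeRK; apply/le_lne/ge_ereal_sup => _ [M [dAE [dBE HM]] <-].
have /eqP <- : expeR (lne (M%:R : R)%:E) == (M%:R)%:E by rewrite lneK_eq lee_fin.
by rewrite lee_expeR; exact: achievable_ppv HM.
Qed.

Lemma max_size_ppv : (lne (max_size eps E) <= ppv eps W)%E.
Proof.
apply: le_trans max_size_EA_ppv; apply: le_lne.
apply: ge_ereal_sup => _ [M HM <-]; apply: ereal_sup_ubound.
by exists M => //; exists 1%N, 1%N.
Qed.

End Codes.

(** * The converse bounds and their reduction to PPV *)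

Local Open Scope ring_scope.
Local Open Scope ereal_scope.

Theorem mainTheorem6 (R : realType) (dA dB : nat) (E : opmap R dA dB) (eps : R)
    (hA : (0 < dA)%N) (hB : (0 < dB)%N)
    (hE : classical_channel E) (heps : (0 <= eps <= 1)%R) :
  let W := transition E in
  (* the two converse bounds *)
  lne (max_size_EA eps E)
    <= max_info (@class_ALL R) false false false eps E /\
  (forall Om : opclass R, is_opclass Om -> subclass (@class_L R) Om ->
     lne (max_size eps E) <= max_info Om false false false eps E) /\
  (* the restrictions and the reduction to the PPV converse *)
  (forall Om : opclass R, is_opclass Om ->
     Om = @class_ALL R \/ subclass (@class_L R) Om ->
     [/\ (* any of the three restrictions may be imposed in the bound *)
         forall rdiag sdiag tdiag : bool,
           max_info Om rdiag sdiag tdiag eps E = ppv eps W,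
         (* average input state *)
         forall rho, density rho ->
           info Om false false eps E rho
             <= info Om false false eps E (dephase rho),
         (* output state *)
         forall (p : 'I_dA -> R) (sdiag tdiag : bool), is_dist p ->
           info Om sdiag tdiag eps E (diag_state p) = ppv_info eps W p &
         (* test *)
         forall (p : 'I_dA -> R) (q : 'I_dB -> R) (tdiag : bool),
           is_dist p -> is_dist q ->
           beta Om tdiag eps (joint_state E (diag_state p))
                (product_state (diag_state p) (diag_state q))
           = ppv_beta eps W p q]) /\
  (* the maximum and the minima in the PPV converse are attained *)
  (exists p : 'I_dA -> R, is_dist p /\ ppv eps W = ppv_info eps W p) /\
  (forall p : 'I_dA -> R, is_dist p ->
     exists q : 'I_dB -> R, is_dist q /\
       ppv_info eps W p = - lne (ppv_beta eps W p q)) /\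
  (forall (p : 'I_dA -> R) (q : 'I_dB -> R), is_dist p -> is_dist q ->
     exists T : 'I_dA * 'I_dB -> R, is_test eps (joint_dist W p) T /\
       ppv_beta eps W p q = (\sum_k product_dist p q k * T k)%R%:E).
Proof.
move=> W; have /andP[eps0 _] := heps; have Wd := transition_dist hE.
have ALL_opclass : is_opclass (@class_ALL R) by [].
split; first by rewrite max_info_ppv //; [exact: max_size_EA_ppv|left].
split.
  move=> Om HOm LOm; rewrite max_info_ppv //; last by right.
  exact: max_size_ppv.
split.
  move=> Om HOm LOm; split.
  - by move=> rdiag sdiag tdiag; exact: max_info_ppv.
  (* The dephased state is [diag_state] of the diagonal of [rho], where the information equals the
     PPV quantity that bounds it at [rho]. *)
  - move=> rho drho; rewrite (dephase_diag_state drho.1) info_diag_state //.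
      exact: info_le_ppv_info drho.1.
    exact: density_dist.
  - by move=> p sdiag tdiag dp; exact: info_diag_state.
  - by move=> p q tdiag dp dq; exact: beta_diag_state.
split; first by have [p dp Hp] := ppv_attained Wd eps0 hA; exists p.
split=> [p dp|p q dp dq].
  by have [q dq Hq] := ppv_info_attained Wd eps0 hB dp; exists q.
by have [T HT Hb] := ppv_beta_attained Wd eps0 q dp; exists T.
Qed.
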